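(* Let $\mathsf{k}$ be a field of characteristic zero, let $T=(1,3^k,1)$ and $j=k+1$. Consider the following Jordan degree types. #1: $((j+1)_0,((j-1)_1)^2)$; #2: $((j+1)_0,(j-1)_1,1\uparrow_1^{j-1})$; #3: $((j+1)_0,2\uparrow_1^{j-2},1_1,1_{j-1})$; #4: $((j+1)_0,(1\uparrow_1^{j-1})^2)$; #5: $(j_0,j_1,(j-1)_1)$; #6: $(j_0,j_1,1\uparrow_1^{j-1})$; #7: $(3\uparrow_0^{j-2},1_1,1_{j-1})$; #8: $(2\uparrow_0^{j-1},1\uparrow_1^{j-1})$; #9 (only for $k=2$): $(2\uparrow_0^2,2_1)$. A. If $k\ge 3$, then #1–#8 are eight distinct Jordan degree types, and they are exactly the Jordan degree types $\mathcal{S}_{A,\ell}$ that occur for pairs $(A,\ell)$ with $A\in\mathrm{Gor}(T)$ and $\ell\in A_1$ a nonzero linear form. B. If $k=2$, then #2 coincides with #3 and #6 coincides with #7, and the occurring Jordan degree types are exactly those among #1–#8 together with the extra one #9. If $k=1$, the only distinct occurring Jordan degree types are #1 and #8.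
   Context: $R=\mathsf{k}[x,y,z]$ with the standard grading; $3^k$ means that $3$ is repeated $k$ times. $\mathrm{Gor}(T)$ is the family of graded Artinian Gorenstein quotients $A=R/I$ with Hilbert function $T$; $j$ is the socle degree. Jordan degree type (JDT): for a graded Artinian algebra $A$ and $\ell\in A_1$, $A$ is a direct sum of graded cyclic $\mathsf{k}[\ell]$-modules (strings) $\langle v_i,\ell v_i,\dots,\ell^{p_i-1}v_i\rangle$ with $v_i$ homogeneous of degree $\nu_i$ and $\ell^{p_i}v_i=0$; the multiset $\mathcal{S}_{A,\ell}=\{(p_i,\nu_i)\}$ is uniquely determined by $(A,\ell)$ and is called the Jordan degree type. Notation: $p_\nu$ denotes the pair $(p,\nu)$ (a string of length $p$ starting in degree $\nu$); $p\uparrow_a^b$ denotes the collection $p_a,p_{a+1},\dots,p_b$ (empty if $b<a$); an exponent denotes multiplicity. *)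

(* Defs.v *)
From HB Require Import structures.
From mathcomp Require Import all_boot all_order all_algebra all_field.
From mathcomp Require Import finmap multiset.
From mathcomp Require Import mpoly.

Set Implicit Arguments.
Unset Strict Implicit.
Unset Printing Implicit Defensive.

Import GRing.Theory.
Local Open Scope mset_scope.
Local Open Scope ring_scope.

(* A quotient A = R/I of R = K[x,y,z] is represented by a K-algebra A together
   with a surjective K-algebra morphism pi : R -> A; then I is the kernel of pi.
   A falgType is finite-dimensional over K, so A is Artinian; it is
   commutative because pi is surjective. *)
Section Quotient.

Variables (K : fieldType) (A : falgType K).
Variable pi : {lrmorphism {mpoly K[3]} -> A}.

Definition graded_quotient : Prop :=
  (forall a : A, exists p, pi p = a) /\
  (forall p, pi p = 0 -> forall d, pi (pihomog mdeg d p) = 0).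

(* A_d, the image of the space R_d of forms of degree d *)
Definition Adeg (d : nat) : {vspace A} :=
  limg (linfun (fun p : dhomog 3 K d => pi (mpoly_of_dhomog p))).

(* the socle (0 : m), where m is spanned by the A_d with d > 0 *)
Definition in_socle (a : A) : Prop :=
  forall d b, (0 < d)%N -> b \in Adeg d -> b * a = 0.

Definition gorenstein : Prop :=
  exists S : {vspace A}, (forall a, a \in S <-> in_socle a) /\ \dim S = 1%N.

Definition Gor (T : nat -> nat) : Prop :=
  [/\ graded_quotient, gorenstein & forall d, \dim (Adeg d) = T d].

End Quotient.

(* A string is coded by (v, (p, nu)): generator v, length p, starting degree nu.
   The condition 0 < p excludes spurious empty strings. *)
Definition is_JDT (K : fieldType) (A : falgType K) (gr : nat -> {vspace A})
    (l : A) (D : {mset nat * nat}) : Prop :=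
  exists s : seq (A * (nat * nat)),
    [/\ forall v p nu, (v, (p, nu)) \in s ->
          [/\ (0 < p)%N, v \in gr nu & l ^+ p * v = 0],
        basis_of fullv
          (flatten [seq [seq l ^+ a * w.1 | a <- iota 0 w.2.1] | w <- s])
      & D = seq_mset [seq w.2 | w <- s]].

(* the sequence T = (1, 3^k, 1), extended by 0 *)
Definition T131 (k d : nat) : nat := nth 0%N (1%N :: rcons (nseq k 3%N) 1%N) d.

Definition occurs (K : fieldType) (k : nat) (D : {mset nat * nat}) : Prop :=
  exists (A : falgType K) (pi : {lrmorphism {mpoly K[3]} -> A}) (l : A),
    [/\ Gor pi (T131 k), l \in Adeg pi 1, l != 0 & is_JDT (Adeg pi) l D].

Local Open Scope nat_scope.

(* p_a, p_(a+1), ..., p_b; empty if b < a *)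
Definition up (p a b : nat) : seq (nat * nat) :=
  [seq (p, nu) | nu <- index_iota a b.+1].

Definition jdt1 (j : nat) : {mset nat * nat} :=
  seq_mset [:: (j.+1, 0); (j.-1, 1); (j.-1, 1)].
Definition jdt2 (j : nat) : {mset nat * nat} :=
  seq_mset ([:: (j.+1, 0); (j.-1, 1)] ++ up 1 1 (j - 1)).
Definition jdt3 (j : nat) : {mset nat * nat} :=
  seq_mset ((j.+1, 0) :: up 2 1 (j - 2) ++ [:: (1, 1); (1, j - 1)]).
Definition jdt4 (j : nat) : {mset nat * nat} :=
  seq_mset ((j.+1, 0) :: up 1 1 (j - 1) ++ up 1 1 (j - 1)).
Definition jdt5 (j : nat) : {mset nat * nat} :=
  seq_mset [:: (j, 0); (j, 1); (j.-1, 1)].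
Definition jdt6 (j : nat) : {mset nat * nat} :=
  seq_mset ([:: (j, 0); (j, 1)] ++ up 1 1 (j - 1)).
Definition jdt7 (j : nat) : {mset nat * nat} :=
  seq_mset (up 3 0 (j - 2) ++ [:: (1, 1); (1, j - 1)]).
Definition jdt8 (j : nat) : {mset nat * nat} :=
  seq_mset (up 2 0 (j - 1) ++ up 1 1 (j - 1)).
Definition jdt9 : {mset nat * nat} :=
  seq_mset (up 2 0 2 ++ [:: (2, 1)]).

Definition jdts (j : nat) : seq {mset nat * nat} :=
  [:: jdt1 j; jdt2 j; jdt3 j; jdt4 j; jdt5 j; jdt6 j; jdt7 j; jdt8 j].

(* Main.v *)
From HB Require Import structures.
Require Import Defs.
From mathcomp Require Import all_boot all_order all_algebra all_field.
From mathcomp Require Import finmap multiset.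
From mathcomp Require Import mpoly.
From mathcomp Require Import zify ring.

(** Fix a linear form l of A, write A_i for the degree i part and j = k+1 for
the socle degree.  The number of strings that pass through all the degrees
from i to i+a is the rank of l^a : A_i -> A_(i+a) ([nstr_rank]), and a multiset
of strings can be recovered from these numbers by inclusion-exclusion
([eq_nstr]).  Hence a Jordan degree type is the same thing as a table of ranks,
and the classification is a list of the possible tables.

For i = 0 or i+a = j the rank is 1 or 0 according to whether l^a is nonzero,
because A_0 is the ground field and the multiplication pairing
A_(j-a) x A_a -> A_j is perfect.  When j >= 4, all the other ranks depend on a
alone.  Indeed some linear form u maps A_i bijectively onto A_(i+1) whenever
1 <= i <= j-2 ([exists_iso]), and u commutes with l^a.  To find u, take a
nonzero linear form; if it does not do, it is killed by some linear form v, and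
the growth bound of Macaulay for quotients of k[y,z] ([macaulay_bound]) shows
that one of the two has rank one on A_1.  From a rank one form v a suitable u
is built by hand, according to whether v^2 is zero ([rank_one_nilpotent]) or
not ([rank_one_idempotent]).

Write rho_a for the common rank of l^a in the middle degrees.  The number of
strings with given first and last degree is not negative, which makes rho
convex; with rho_0 = 3 this leaves 3,3,3,... and 3,2,2,... and 3,2,1,1,... and
3,2,1,0,... and 3,1,1,... and 3,1,0,...  Perfectness of the pairing and a
stabilization argument determine which powers of l vanish, up to the choice
between l^j = 0 and l^j <> 0 when rho is eventually 3 or 2 (and between l^3 = 0
and l^4 <> 0 for the sequence 3,2,1 when j = 4).  This gives the eight
types ([classify4]).  For j = 2 and j = 3 there are so few middle degrees that
the counting inequalities suffice.

Conversely, let C be a commutative algebra of dimension 3 with a linear form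
phi whose bilinear form phi(xy) is nondegenerate.  Then
K + Ct + ... + Ct^k + (C/ker phi)t^(k+1) is in Gor(1,3^k,1), and for l = ct with
c in C the middle ranks are the ranks of the powers of c on C while l^j is
phi(c^j).  The algebras C = K x K[e]/(e^2) and C = K[X]/(X^3) produce #1 to #8
by a suitable choice of c and phi ([occurs1] to [occurs8]).  The type #9 is
that of l = x in K[x,y,z]/(x^2, y^2, z^2) ([occurs9]). *)

Set Implicit Arguments.
Unset Strict Implicit.
Unset Printing Implicit Defensive.

Import GRing.Theory.

Local Open Scope mset_scope.

(** * Counting the strings of a Jordan degree type *)

Local Open Scope nat_scope.

(** The string w = (p, nu) occupies the degrees nu, ..., nu + p - 1; the test is that
it meets every degree from i to i + a. *)
Definition covers (i a : nat) (w : nat * nat) : bool :=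
  (w.2 <= i) && (i + a < w.2 + w.1).

Definition nstr (D : seq (nat * nat)) (i a : nat) : nat := count (covers i a) D.

Lemma nstr_seq_mset t i a : nstr (seq_mset t) i a = nstr t i a.
Proof. by apply/permP/perm_eq_seq_mset. Qed.

Lemma nstr_cat s t i a : nstr (s ++ t) i a = nstr s i a + nstr t i a.
Proof. exact: count_cat. Qed.

Lemma nstr_nil i a : nstr [::] i a = 0.
Proof. by []. Qed.

Lemma nstr_cons w s i a : nstr (w :: s) i a = covers i a w + nstr s i a.
Proof. by []. Qed.

(** The difference of the two sides counts the strings that start in degree
i + 1 and end in degree i + a + 1; that this number is not negative
is what makes the sequence of the middle ranks convex. *)
Lemma nstr_convex D i a :
  nstr D i.+1 a.+1 + nstr D i a.+1 <= nstr D i.+1 a + nstr D i a.+2.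
Proof. by rewrite /nstr; elim: D => //= -[p nu] D; rewrite /covers /=; lia. Qed.

Lemma nstr_decr D i a : nstr D i a.+1 <= nstr D i a.
Proof. by rewrite /nstr; elim: D => //= -[p nu] D; rewrite /covers /=; lia. Qed.

(** Inclusion-exclusion over the two ends of a string, written without
subtraction.  The case distinction on nu removes the terms that would refer to
degree nu - 1 when nu = 0. *)
Lemma count_mem_nstr (s : seq (nat * nat)) p nu :
  count_mem (p.+1, nu) s + (if nu is n.+1 then nstr s n p.+1 else 0)
    + nstr s nu p.+1
  = nstr s nu p + (if nu is n.+1 then nstr s n p.+2 else 0).
Proof.
rewrite /nstr; elim: s => [|[q m] s IH] /=; first by case: nu.
rewrite /covers /= xpair_eqE; case: nu IH => [|n]; rewrite /covers /=; lia.
Qed.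

Lemma eq_nstr (D D' : {mset nat * nat}) :
    {in D, forall w, 0 < w.1} -> {in D', forall w, 0 < w.1} ->
  (forall i a, nstr D i a = nstr D' i a) -> D = D'.
Proof.
move=> D_gt0 D'_gt0 eqDD'.
rewrite -[D]seq_mset_id -[D']seq_mset_id; apply/eq_seq_msetP/allP => -[p nu].
rewrite mem_cat => pnu_in; apply/eqP.
have: 0 < p by case/orP: pnu_in => [/D_gt0|/D'_gt0].
case: p {pnu_in} => // p _.
have := count_mem_nstr D p nu; have := count_mem_nstr D' p nu.
rewrite !eqDD'; case: nu => [|n]; rewrite ?eqDD' => <- /eqP.
  by rewrite !eqn_add2r => /eqP.
by rewrite !eqn_add2r => /eqP.
Qed.

#[local] Arguments up : simpl never.

Lemma nstr_up p x y i a :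
  nstr (up p x y) i a = minn i.+1 (maxn x y.+1) - maxn x (i + a + 1 - p).
Proof.
rewrite /nstr /up count_map /index_iota.
have ->: maxn x y.+1 = x + (y.+1 - x) by lia.
move: (y.+1 - x) => n; elim: n x => [|n IH] x /=; first by lia.
by rewrite IH /covers /=; lia.
Qed.

(** The shape shared by all the tables of ranks that occur: sigma a tells
whether l^a is nonzero, which decides the rank of l^a out of A_0 or into A_j,
and rho a is the rank of l^a between two middle degrees. *)
Definition has_table (D : seq (nat * nat)) (j : nat) (rho sigma : nat -> nat) :=
  forall i a, nstr D i a =
    if j < i + a then 0 else if (i == 0) || (i + a == j) then sigma a else rho a.

Ltac table_tac :=
  move=> i [|[|[|a]]]; rewrite nstr_seq_mset ?(nstr_cat, nstr_cons, nstr_up,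
    nstr_nil) ?/covers /=;
  repeat case: ifP; lia.

Lemma table1 j : 2 <= j ->
  has_table (jdt1 j) j (fun=> 3) (fun=> 1).
Proof. move=> ?; table_tac. Qed.

Lemma table2 j : 3 <= j ->
  has_table (jdt2 j) j (fun a => if a is 0 then 3 else 2) (fun=> 1).
Proof. move=> ?; table_tac. Qed.

Lemma table3 j : 3 <= j ->
  has_table (jdt3 j) j (fun a => if a is a'.+1 then if a' is 0 then 2 else 1 else 3)
    (fun=> 1).
Proof. move=> ?; table_tac. Qed.

Lemma table4 j : 3 <= j ->
  has_table (jdt4 j) j (fun a => if a is 0 then 3 else 1) (fun=> 1).
Proof. move=> ?; table_tac. Qed.

Lemma table5 j : 3 <= j ->
  has_table (jdt5 j) j (fun a => 3) (fun a => a < j).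
Proof. move=> ?; table_tac. Qed.

Lemma table6 j : 3 <= j ->
  has_table (jdt6 j) j (fun a => if a is 0 then 3 else 2) (fun a => a < j).
Proof. move=> ?; table_tac. Qed.

Lemma table7 j : 3 <= j ->
  has_table (jdt7 j) j (fun a => 3 - a) (fun a => a < 3).
Proof. move=> ?; table_tac. Qed.

Lemma table8 j : 2 <= j ->
  has_table (jdt8 j) j (fun a => if a is a'.+1 then a' == 0 else 3) (fun a => a < 2).
Proof. move=> ?; table_tac. Qed.

Lemma table9 :
  has_table jdt9 3 (fun a => 3 - a) (fun a => a < 2).
Proof. table_tac. Qed.

(** Only the values rho a with a <= j - 2 and sigma a with a <= j appear in a table. *)
Lemma eq_table (D D' : {mset nat * nat}) j rho sigma rho' sigma' :
    {in D, forall w, 0 < w.1} -> {in D', forall w, 0 < w.1} ->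
    has_table D j rho sigma -> has_table D' j rho' sigma' ->
    (forall a, a.+2 <= j -> rho a = rho' a) ->
    (forall a, a <= j -> sigma a = sigma' a) ->
  D = D'.
Proof.
move=> Dgt0 D'gt0 tD tD' eq_rho eq_sigma; apply: eq_nstr => // i a.
rewrite tD tD'; case: ifP => // ?; case: ifP => ?; first by rewrite eq_sigma; lia.
by rewrite eq_rho; lia.
Qed.

Lemma jdts_gt0 j (D : {mset nat * nat}) : 2 <= j -> D \in jdt9 :: jdts j ->
  {in D, forall w, 0 < w.1}.
Proof.
move=> j_ge2 D_in; apply/allP; move: D D_in; apply/allP.
have mset_all t : all (fun w : nat * nat => 0 < w.1) (seq_mset t)
    = all (fun w => 0 < w.1) t.
  exact/perm_all/perm_eq_seq_mset.
have iota_all p x n : 0 < p -> all (fun w => 0 < w.1) [seq (p, nu) | nu <- iota x n].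
  by move=> p_gt0; apply/allP => _ /mapP[nu _ ->].
have up_all p x y : 0 < p -> all (fun w => 0 < w.1) (up p x y) by apply: iota_all.
case: j j_ge2 => [|[|n]] // _.
by rewrite /= !mset_all /= ?all_cat /= ?up_all ?iota_all.
Qed.

(** The type is determined by whether l^j is nonzero together with the ranks of l and l^2
out of A_1; j >= 4 is what makes A_3 a middle degree. *)
Lemma jdts_uniq j : 4 <= j -> uniq (jdts j).
Proof.
move=> j4; pose code D := (nstr D 0 j, (nstr D 1 1, nstr D 1 2)).
have codeE D rho sigma : has_table D j rho sigma -> code D = (sigma j, (rho 1, rho 2)).
  by move=> tD; rewrite /code; congr (_, (_, _)); rewrite tD /=; repeat case: ifP; lia.
have [j2 j3] : 2 <= j /\ 3 <= j by lia.
apply: (@map_uniq _ _ (fun D : {mset nat * nat} => code D)) => /=.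
rewrite (codeE _ _ _ (table1 j2)) (codeE _ _ _ (table2 j3)) (codeE _ _ _ (table3 j3)).
rewrite (codeE _ _ _ (table4 j3)) (codeE _ _ _ (table5 j3)) (codeE _ _ _ (table6 j3)).
rewrite (codeE _ _ _ (table7 j3)) (codeE _ _ _ (table8 j2)) ltnn.
by have [-> ->] : (j < 2) = false /\ (j < 3) = false by lia.
Qed.

Lemma jdts3_uniq : uniq [:: jdt1 3; jdt2 3; jdt4 3; jdt5 3; jdt6 3; jdt8 3; jdt9].
Proof.
apply: (@map_uniq _ _ (fun D : {mset nat * nat} =>
  (nstr D 0 3, (nstr D 1 1, nstr D 0 2)))) => /=.
by rewrite !nstr_seq_mset.
Qed.

Lemma jdt1_neq_jdt8 : jdt1 2 <> jdt8 2.
Proof. by move/(congr1 (fun D : {mset nat * nat} => nstr D 0 2));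
  rewrite !nstr_seq_mset. Qed.

Lemma jdt2_eq_jdt3 : jdt2 3 = jdt3 3.
Proof. by apply/eq_seq_msetP. Qed.

Lemma jdt6_eq_jdt7 : jdt6 3 = jdt7 3.
Proof. by apply/eq_seq_msetP. Qed.

Lemma mem_jdt1 j : jdt1 j \in jdts j.
Proof. exact: mem_head. Qed.
Lemma mem_jdt2 j : jdt2 j \in jdts j.
Proof. by rewrite /jdts; do 1!(rewrite in_cons; apply/orP; right); exact: mem_head. Qed.
Lemma mem_jdt3 j : jdt3 j \in jdts j.
Proof. by rewrite /jdts; do 2!(rewrite in_cons; apply/orP; right); exact: mem_head. Qed.
Lemma mem_jdt4 j : jdt4 j \in jdts j.
Proof. by rewrite /jdts; do 3!(rewrite in_cons; apply/orP; right); exact: mem_head. Qed.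
Lemma mem_jdt5 j : jdt5 j \in jdts j.
Proof. by rewrite /jdts; do 4!(rewrite in_cons; apply/orP; right); exact: mem_head. Qed.
Lemma mem_jdt6 j : jdt6 j \in jdts j.
Proof. by rewrite /jdts; do 5!(rewrite in_cons; apply/orP; right); exact: mem_head. Qed.
Lemma mem_jdt7 j : jdt7 j \in jdts j.
Proof. by rewrite /jdts; do 6!(rewrite in_cons; apply/orP; right); exact: mem_head. Qed.
Lemma mem_jdt8 j : jdt8 j \in jdts j.
Proof. by rewrite /jdts; do 7!(rewrite in_cons; apply/orP; right); exact: mem_head. Qed.

Section Classification.

Variables (D : {mset nat * nat}) (j : nat) (rho sigma : nat -> nat).
Hypotheses (Dgt0 : {in D, forall w, 0 < w.1}) (tD : has_table D j rho sigma).
Hypotheses (rho0 : rho 0 = 3) (sigma0 : sigma 0 = 1) (sigma1 : sigma 1 = 1).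

Lemma sigma_decr a : a < j -> sigma a.+1 <= sigma a.
Proof. by move=> a_lt; have := nstr_decr D 0 a; rewrite !tD /=; repeat case: ifP; lia. Qed.

Lemma sigma_le1 a : a <= j -> sigma a <= 1.
Proof. by elim: a => [|a IH] a_lt; [rewrite sigma0|have := sigma_decr a_lt; lia]. Qed.

Lemma rho_decr a : a.+3 <= j -> rho a.+1 <= rho a.
Proof.
by move=> a_lt; have := nstr_decr D 1 a; rewrite !tD /=; repeat case: ifP; lia.
Qed.

Lemma rho_convex a : a.+4 <= j -> 2 * rho a.+1 <= rho a + rho a.+2.
Proof.
by move=> a_lt; have := nstr_convex D 1 a; rewrite !tD /=; repeat case: ifP; lia.
Qed.

(** A convex nonincreasing sequence that repeats a value once is constant from
there on. *)
Lemma rho_stable a n : rho a.+1 = rho a -> a + n + 2 <= j -> rho (a + n) = rho a.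
Proof.
move=> rho_a; elim: n => [|n IH] n_lt; first by rewrite addn0.
rewrite addnS -IH; last lia.
elim: n {IH} n_lt => [|n IH] n_lt; first by rewrite addn0.
have {IH}eq_n : rho (a + n).+1 = rho (a + n) by apply: IH; lia.
rewrite addnS; apply/eqP; rewrite eqn_leq rho_decr ?andTb; last lia.
by have := @rho_convex (a + n); rewrite eq_n; lia.
Qed.

Lemma eq_jdt (D' : {mset nat * nat}) rho' sigma' :
    2 <= j -> D' \in jdt9 :: jdts j -> has_table D' j rho' sigma' ->
    (forall a, a.+2 <= j -> rho a = rho' a) ->
    (forall a, a <= j -> sigma a = sigma' a) -> D = D'.
Proof. by move=> j2 /(jdts_gt0 j2) D'gt0 tD'; apply: eq_table tD tD'. Qed.

(** If l^(j-1) is nonzero and l^j = 0, the strings through [0, j-1] and through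
[1, j] are different, so that two strings pass through [1, j-1]. *)
Lemma sigma_last : 2 <= j -> 2 * sigma j.-1 <= rho j.-2 + sigma j.
Proof.
case: j tD => [|[|n]] // tDn _ /=; have := nstr_convex D 0 n; rewrite !tDn /=.
by repeat case: ifP; lia.
Qed.

Lemma rho1_le : 3 <= j -> rho 1 + sigma 1 <= rho 0 + sigma 2.
Proof.
by move=> j3; have := nstr_convex D 0 0; rewrite !tD /=; repeat case: ifP; lia.
Qed.

Lemma sigma_mono a b : a <= b -> b <= j -> sigma b <= sigma a.
Proof.
move=> /subnK <-; elim: (b - a) => [|n IH] // n_le.
by have := @sigma_decr (n + a); rewrite addSn; lia.
Qed.

Lemma mem_jdts (D' : {mset nat * nat}) rho' sigma' :
    D' \in jdts j -> 2 <= j -> has_table D' j rho' sigma' ->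
    (forall a, a.+2 <= j -> rho a = rho' a) ->
    (forall a, a <= j -> sigma a = sigma' a) -> D \in jdts j.
Proof.
move=> D'_in j2 tD' eq_rho eq_sigma.
by rewrite (eq_jdt j2 _ tD') // in_cons D'_in orbT.
Qed.

Lemma classify2 : j = 2 -> D = jdt1 2 \/ D = jdt8 2.
Proof.
move=> j2; have [s2|s2] : sigma 2 = 1 \/ sigma 2 = 0.
- by have := @sigma_le1 2; rewrite j2; lia.
- left; rewrite -j2; apply: (eq_jdt _ _ (table1 _)); rewrite ?j2 //.
  + by rewrite in_cons mem_jdt1 orbT.
  + by case.
  + by do 3!case=> //.
- right; rewrite -j2; apply: (eq_jdt _ _ (table8 _)); rewrite ?j2 //.
  + by rewrite in_cons mem_jdt8 orbT.
  + by case.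
  + by do 3!case=> //.
Qed.

Lemma classify3 : j = 3 -> 1 <= rho 1 -> D \in rcons (jdts 3) jdt9.
Proof.
move=> j3 r1; rewrite mem_rcons in_cons.
have j_ge3 : 3 <= j by rewrite j3.
have := rho_decr j_ge3; have := rho1_le j_ge3; have := sigma_last.
have := @sigma_le1 2; have := @sigma_le1 3; have := @sigma_decr 2.
rewrite rho0 sigma1 j3 /= => s32 s3 s2 last r1_le r1_le3; rewrite -j3.
have [s2_0|s2_1] : sigma 2 = 0 \/ sigma 2 = 1 by lia.
- have [r1_2|r1_1] : rho 1 = 2 \/ rho 1 = 1 by lia.
  + apply/predU1P; left; apply: (eq_jdt _ (mem_head _ (jdts j))); first by rewrite j3.
    * by rewrite j3; apply: table9.
    * by rewrite j3; do 2!case=> //.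
    * by rewrite j3; do 4!case=> //; lia.
  + apply/orP; right; refine (mem_jdts (mem_jdt8 j) _ (table8 _) _ _); rewrite ?j3 //.
      by do 2!case=> //.
    by do 4!case=> //; lia.
- apply/orP; right; have [s3_0|s3_1] : sigma 3 = 0 \/ sigma 3 = 1 by lia.
  + have [r1_2|r1_3] : rho 1 = 2 \/ rho 1 = 3 by lia.
      refine (mem_jdts (mem_jdt6 j) _ (table6 _) _ _); rewrite ?j3 //.
        by do 2!case=> //.
      by do 4!case=> //; lia.
    refine (mem_jdts (mem_jdt5 j) _ (table5 _) _ _); rewrite ?j3 //.
      by do 2!case=> //.
    by do 4!case=> //; lia.
  + have [r1_3|[r1_2|r1_1]] : rho 1 = 3 \/ rho 1 = 2 \/ rho 1 = 1 by lia.
    * refine (mem_jdts (mem_jdt1 j) _ (table1 _) _ _); rewrite ?j3 //.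
        by do 2!case=> //.
      by do 4!case=> //; lia.
    * refine (mem_jdts (mem_jdt2 j) _ (table2 _) _ _); rewrite ?j3 //.
        by do 2!case=> //.
      by do 4!case=> //; lia.
    * refine (mem_jdts (mem_jdt4 j) _ (table4 _) _ _); rewrite ?j3 //.
        by do 2!case=> //.
      by do 4!case=> //; lia.
Qed.

(** For a < j no nonzero element of A_a is killed by A_1, so l^a vanishes
exactly when l^a A_1 does. *)
Hypothesis sigma_rho : forall a, a.+2 <= j -> (0 < sigma a) = (0 < rho a).
(** This is where the algebra structure is used and not only the counting
inequalities; see [jdt_classified]. *)
Hypothesis sigma_top : forall a, a.+3 <= j -> 0 < rho a -> rho a.+1 = rho a ->
  0 < sigma j.-1.

(** Convexity bounds rho from below by its linear continuation, so rho 1 and rho 2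
(and rho 3 after 3, 2, 1) determine rho.  For j = 4 the sequence 3, 2, 1 has no
further term and belongs to both #3 and #7, which then differ by l^3. *)
Lemma classify4 : 4 <= j -> D \in jdts j.
Proof.
move=> j4; have [j2 j3] : 2 <= j /\ 3 <= j by lia.
have r01 : rho 1 <= rho 0 by apply: rho_decr; lia.
have r12 : rho 2 <= rho 1 by apply: rho_decr; lia.
have r012 : 2 * rho 1 <= rho 0 + rho 2 by apply: rho_convex.
have r1_gt0 : 0 < rho 1 by rewrite -sigma_rho ?sigma1.
have s_le1 := @sigma_le1; have s_mono := @sigma_mono; have s_last := sigma_last j2.
have stab m c b : m.+3 <= j -> rho m.+1 = rho m -> rho m = c -> m <= b -> b.+2 <= j ->
  rho b = c.
  by move=> _ eq_m <- /subnKC <- b_lt; apply: rho_stable => //; lia.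
have top m : m.+3 <= j -> 0 < rho m -> rho m.+1 = rho m ->
    (forall a, a < j -> sigma a = 1).
  move=> m_lt m_gt0 /(sigma_top m_lt m_gt0) s_gt0 a a_lt.
  by have := s_mono a j.-1; have := s_le1 a; lia.
have [r1|[r1|r1]] : rho 1 = 3 \/ rho 1 = 2 \/ rho 1 = 1 by lia.
- have rE b : b.+2 <= j -> rho b = 3 by apply: (stab 0) => //; lia.
  have sE : forall a, a < j -> sigma a = 1 by apply: (top 0); lia.
  have [s0|s1] : sigma j = 0 \/ sigma j = 1 by have := s_le1 j; lia.
  + refine (mem_jdts (mem_jdt5 j) _ (table5 _) _ _) => // a;
      rewrite leq_eqVlt => /predU1P[->|a_lt].
      by rewrite ltnn.
    by rewrite a_lt sE.
  + refine (mem_jdts (mem_jdt1 j) _ (table1 _) _ _) => // a;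
      rewrite leq_eqVlt => /predU1P[->//|a_lt].
    by rewrite sE.
- have [r2|r2] : rho 2 = 2 \/ rho 2 = 1 by lia.
  + have rE b : b.+2 <= j -> rho b = if b is 0 then 3 else 2.
      by case: b => // b b_lt; apply: (stab 1); lia.
    have sE : forall a, a < j -> sigma a = 1 by apply: (top 1); lia.
    have [s0|s1] : sigma j = 0 \/ sigma j = 1 by have := s_le1 j; lia.
    * refine (mem_jdts (mem_jdt6 j) _ (table6 _) _ _) => // a;
        rewrite leq_eqVlt => /predU1P[->|a_lt].
        by rewrite ltnn.
      by rewrite a_lt sE.
    * refine (mem_jdts (mem_jdt2 j) _ (table2 _) _ _) => // a;
        rewrite leq_eqVlt => /predU1P[->//|a_lt].
      by rewrite sE.
  + have jdt3P : sigma j.-1 = 1 -> (forall b, 2 <= b -> b.+2 <= j -> rho b = 1) ->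
      D \in jdts j.
      move=> sl rE; have rl : rho j.-2 = 1 by apply: rE; lia.
      refine (mem_jdts (mem_jdt3 j) _ (table3 _) _ _) => // a.
        by case: a => [|[|a]] // a_lt; apply: rE.
      by move=> a_le; have := s_mono a j; have := s_le1 a; have := s_le1 j; lia.
    have jdt7P : sigma 3 = 0 -> (forall b, 3 <= b -> b.+2 <= j -> rho b = 0) ->
      D \in jdts j.
      move=> s3 rE; refine (mem_jdts (mem_jdt7 j) _ (table7 _) _ _) => // a.
        by case: a => [|[|[|a]]] // a_lt; rewrite rE.
      case: a => [|[|[|a]]] // a_lt; last by have := s_mono 3 a.+3; lia.
      by have := sigma_rho j4; have := s_le1 2; rewrite r2; lia.
    have [j_eq4|j5] : j = 4 \/ 5 <= j by lia.
    * have [s0|s1] : sigma 3 = 0 \/ sigma 3 = 1 by have := s_le1 3; lia.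
        by apply: jdt7P => // b; lia.
      by apply: jdt3P => [|b b2 b_lt]; rewrite ?j_eq4 //; have -> : b = 2 by lia.
    * have r23 : rho 3 <= rho 2 by apply: rho_decr; lia.
      have [r3|r3] : rho 3 = 0 \/ rho 3 = 1 by lia.
        apply: jdt7P => [|b b3 b_lt]; first by have := sigma_rho j5; have := s_le1 3;
          rewrite r3; lia.
        elim: b b3 b_lt => // b IH b3 b_lt; have [->//|b_ge3] : b = 2 \/ 3 <= b by lia.
        by have := @rho_decr b b_lt; rewrite IH; lia.
      by apply: jdt3P => [|b b2 b_lt]; [apply: (top 2); lia|apply: (stab 2); lia].
- have [r2|r2] : rho 2 = 0 \/ rho 2 = 1 by lia.
  + have s2 : sigma 2 = 0 by have := sigma_rho j4; rewrite r2; lia.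
    refine (mem_jdts (mem_jdt8 j) _ (table8 _) _ _) => // a.
      case: a => [|[|a]] //; elim: a => [//|b IH] b_lt.
      by have := @rho_decr b.+2 b_lt; rewrite IH; lia.
    by case: a => [|[|a]] // a_lt; have := s_mono 2 a.+2; lia.
  + have rE b : 1 <= b -> b.+2 <= j -> rho b = 1 by apply: (stab 1) => //; lia.
    have sE : forall a, a < j -> sigma a = 1 by apply: (top 1); lia.
    refine (mem_jdts (mem_jdt4 j) _ (table4 _) _ _) => // a; first by case: a => // a;
      apply: rE.
    move=> a_le; have [->|/sE //] : a = j \/ a < j by lia.
    by have := s_le1 j; have := sE j.-1; have := rE j.-2; lia.
Qed.

End Classification.

(** * Graded Gorenstein quotients and the ranks of powers of a linear form *)

Local Open Scope ring_scope.

Section Quotient.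

Variables (K : fieldType) (A : falgType K) (pi : {lrmorphism {mpoly K[3]} -> A}).

Lemma AdegP d (a : A) :
  reflect (exists2 p, p \is d.-homog & pi p = a) (a \in Adeg pi d).
Proof.
pose f : {linear dhomog 3 K d -> A} := pi \o @mpoly_of_dhomog 3 K d.
have fE : Adeg pi d = limg (linfun f) by [].
rewrite fE; apply: (iffP memv_imgP) => [[p _ ->]|[p p_homog <-]].
  by rewrite lfunE; exists (mpoly_of_dhomog p) => //; apply: dhomog_is_dhomog.
by exists (DHomog p_homog); rewrite ?memvf // lfunE.
Qed.

Lemma Adeg_pi d p : p \is d.-homog -> pi p \in Adeg pi d.
Proof. by move=> p_homog; apply/AdegP; exists p. Qed.

Lemma Adeg0 : Adeg pi 0 = 1%VS.
Proof.
apply/vspaceP => a; apply/AdegP/vlineP => [[p p_homog <-]|[c ->]].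
  exists p@_0; have {1}-> : p = p@_0 *: 1; last by rewrite linearZ rmorph1.
  apply/mpolyP => m; rewrite mcoeffZ mcoeff1; case: (eqVneq m 0%MM) => [->|m_neq0].
    by rewrite mulr1.
  by rewrite mulr0 (dhomog_nemf_coeff p_homog) // mdeg_eq0.
by exists (c *: 1); rewrite ?linearZ ?rmorph1 // dhomogZ // dhomog1.
Qed.

(** Every monomial of degree d + 1 is a variable times a monomial of degree d. *)
Lemma AdegS d : Adeg pi d.+1 = (Adeg pi 1 * Adeg pi d)%VS.
Proof.
apply/eqP; rewrite eqEsubv; apply/andP; split; last first.
  apply/prodvP => _ _ /AdegP[p p1 <-] /AdegP[q qd <-].
  by rewrite -rmorphM; apply: Adeg_pi; rewrite -[d.+1]add1n dhomogM.
apply/subvP => _ /AdegP[p p_homog <-].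
rewrite [p]mpolyE linear_sum /= big_seq;
  apply: memv_suml => m /(dhomog_mf p_homog) /= m_deg.
rewrite linearZ memvZ //.
have /forallPn[i]: ~~ [forall i, m i == 0%N].
  apply/negP => /forallP m0; move: m_deg; rewrite mdegE big1 // => i _.
  exact/eqP.
rewrite -lep1mP => mi; have := mdegD (m - U_(i)) U_(i);
  rewrite submK // m_deg mdeg1 addn1 => -[d_eq].
rewrite -(submK mi) mpolyXD mulrC rmorphM /=; apply: memv_mul; apply: Adeg_pi.
  by rewrite dhomogX /= mdeg1.
by rewrite dhomogX /= d_eq.
Qed.

(** This is where the homogeneity of the kernel enters: a relation between
elements of different degrees lifts to the kernel, and so do its components. *)
Lemma Adeg_direct d : graded_quotient pi ->
  directv (\sum_(i < d) Adeg pi i).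
Proof.
move=> [_ homogK]; apply/directv_sum_independent => a aG a_sum0 i _.
have aP (k : 'I_d) : exists p, (p \is k.-homog) && (pi p == a k).
  by have /AdegP[p p_homog pi_p] := aG k isT; exists p; rewrite p_homog pi_p eqxx.
pose p k := xchoose (aP k).
have p_homog k : p k \is k.-homog by case/andP: (xchooseP (aP k)).
have pi_p k : pi (p k) = a k by case/andP: (xchooseP (aP k)) => _ /eqP.
have sum0 : pi (\sum_k p k) = 0.
  by rewrite linear_sum -[RHS]a_sum0; apply: eq_bigr => k _; apply: pi_p.
have pi_sum : pihomog mdeg i (\sum_k p k) = p i.
  rewrite [LHS]raddf_sum (bigD1 i) //= big1 => [|k k_neq].
    by rewrite pihomog_dE ?addr0.
  by rewrite (pihomog_ne0 _ (p_homog k)).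
by have := homogK _ sum0 i; rewrite pi_sum pi_p.
Qed.

Lemma Adeg_full d : graded_quotient pi -> (forall e, (d <= e)%N -> Adeg pi e = 0%VS) ->
  (\sum_(i < d) Adeg pi i)%VS = fullv.
Proof.
move=> [pi_surj _] G0; apply/eqP; rewrite eqEsubv subvf; apply/subvP => a _.
have [p <-] := pi_surj a.
rewrite (@pihomog_partitionE 3 K mdeg _ p (leqnn _)) linear_sum /=; apply: memv_suml => e _.
have e_homog := Adeg_pi (pihomogP mdeg e p).
have [e_lt|/G0 e0] := ltnP e d; first exact: subvP (sumv_sup (Ordinal e_lt) _ _) _ e_homog.
by move: e_homog; rewrite e0 memv0 => /eqP->; apply: mem0v.
Qed.

Lemma Adeg_disjoint d e a : graded_quotient pi -> d != e ->
  a \in Adeg pi d -> a \in Adeg pi e -> a = 0.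
Proof.
move=> [_ homogK] de /AdegP[p p_homog <-] /AdegP[q q_homog pi_q].
have /homogK/(_ d): pi (p - q) = 0 by rewrite linearB /= pi_q subrr.
by rewrite pihomogB pihomog_dE // (pihomog_ne0 _ q_homog) 1?eq_sym // subr0.
Qed.

Lemma quotient_mulC : graded_quotient pi -> forall x y : A, x * y = y * x.
Proof.
case=> surj _ x y; have [p <-] := surj x; have [q <-] := surj y.
by rewrite -!rmorphM mulrC.
Qed.

End Quotient.

(** What the classification uses of a graded Gorenstein quotient.  The socle
condition is stated degree by degree and with multipliers of degree one only, as
A is generated in degree one. *)
Record graded_gorenstein (K : fieldType) (A : falgType K) (G : nat -> {vspace A})
    (j : nat) := GradedGorenstein {
  gg_mulC : forall x y : A, x * y = y * x;
  gg_deg0 : G 0%N = 1%VS;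
  gg_degS : forall d, G d.+1 = (G 1%N * G d)%VS;
  gg_top0 : G j.+1 = 0%VS;
  gg_top1 : \dim (G j) = 1%N;
  gg_socle : forall i x, (i < j)%N -> x \in G i -> {in G 1%N, forall y, y * x = 0} -> x = 0;
  gg_full : (\sum_(i < j.+1) G i)%VS = fullv;
  gg_direct : directv (\sum_(i < j.+1) G i)
}.

Lemma Gor_graded_gorenstein (K : fieldType) (A : falgType K)
    (pi : {lrmorphism {mpoly K[3]} -> A}) k :
  Gor pi (T131 k) -> graded_gorenstein (Adeg pi) k.+1.
Proof.
move=> [quot_pi [S [socS dimS]] dimG].
have G0 e : (k.+1 < e)%N -> Adeg pi e = 0%VS.
  move=> lt_e; apply/eqP; rewrite -dimv_eq0 dimG /T131 nth_default //=.
  by rewrite size_rcons size_nseq.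
have top1 : \dim (Adeg pi k.+1) = 1%N.
  by rewrite dimG /T131 /= nth_rcons size_nseq ltnn eqxx.
have mulC := quotient_mulC quot_pi.
have GM a b : (Adeg pi a * Adeg pi b)%VS = Adeg pi (a + b).
  elim: a => [|a IH]; first by rewrite Adeg0 prod1v.
  by rewrite AdegS -prodvA IH addSn -AdegS.
have topS : Adeg pi k.+1 = S.
  apply/eqP; rewrite eqEdim dimS top1 leqnn andbT; apply/subvP => a aG.
  apply/socS => d b d_gt0 bG; have := memv_mul bG aG.
  by rewrite GM G0 ?memv0 => [/eqP|]; [|lia].
split=> //; first exact: Adeg0.
- exact: G0.
- move=> i x i_lt xG x0; have: x \in S.
    apply/socS => -[//|d] b _; rewrite AdegS => bG.
    have A1x : (Adeg pi 1 * <[x]>)%VS = 0%VS.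
      apply/eqP; rewrite -subv0; apply/prodvP => y _ yG /vlineP[c ->].
      by rewrite -scalerAr x0 // scaler0 mem0v.
    have: b * x \in (Adeg pi d * (Adeg pi 1 * <[x]>))%VS.
      by rewrite prodvA GM addn1 AdegS memv_mul // memv_line.
    by rewrite A1x prodv0 memv0 => /eqP.
  by rewrite -topS; apply: Adeg_disjoint xG; rewrite ?neq_ltn ?i_lt.
- exact: Adeg_full.
- exact: Adeg_direct.
Qed.

Section Graded.

Variables (K : fieldType) (A : falgType K) (G : nat -> {vspace A}) (j : nat).
Hypothesis gg : graded_gorenstein G j.

Lemma gg_mulG a b : (G a * G b)%VS = G (a + b).
Proof.
elim: a => [|a IH]; first by rewrite (gg_deg0 gg) prod1v.
by rewrite (gg_degS gg) -prodvA IH addSn -(gg_degS gg).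
Qed.

Lemma gg_mul a b x y : x \in G a -> y \in G b -> x * y \in G (a + b).
Proof. by rewrite -gg_mulG; apply: memv_mul. Qed.

Lemma gg_above d : (j < d)%N -> G d = 0%VS.
Proof. by move=> /subnK <-; rewrite -gg_mulG (gg_top0 gg) prodv0. Qed.

Lemma gg_exp l a : l \in G 1%N -> l ^+ a \in G a.
Proof.
move=> lG; elim: a => [|a IH]; first by rewrite expr0 (gg_deg0 gg) memv_line.
by rewrite exprS -add1n gg_mul.
Qed.

(** Perfectness of the pairing with A_j: as long as the degree is below j, a
nonzero element stays nonzero after multiplication by a suitable linear form. *)
Lemma gg_pairing a x : (a <= j)%N -> x \in G a ->
  \dim (G (j - a) * <[x]>)%VS = (x != 0).
Proof.
move=> a_le xG; have [->|x_neq0] := eqVneq x 0; first by rewrite prodv0 dimv0.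
have pair_neq0 : (G (j - a) * <[x]>)%VS != 0%VS.
  move: {2}(j - a)%N (erefl (j - a)%N) => n;
    elim: n a x a_le xG x_neq0 => [|n IH] a x a_le xG x_neq0 Dn.
    by rewrite Dn (gg_deg0 gg) prod1v -dimv_eq0 dim_vline x_neq0.
  apply/eqP => pair0; case/eqP: x_neq0; apply: (gg_socle gg) (xG) _; first lia.
  move=> y yG; apply/eqP/negPn/negP => yx_neq0.
  have [a_lt Dn'] : (a < j)%N /\ (j - a.+1 = n)%N by lia.
  have /negP[] := IH _ _ a_lt (gg_mul yG xG) yx_neq0 Dn'.
  rewrite -subv0 -pair0; have -> : (j - a = (j - a.+1) + 1)%N by lia.
  by rewrite -gg_mulG -prodvA prodvS // -memvE memv_mul // memv_line.
apply/eqP; rewrite eqn_leq lt0n dimv_eq0 pair_neq0 andbT -[nat_of_bool _]/1%N -(gg_top1 gg).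
apply: dimvS; have -> : G j = (G (j - a) * G a)%VS by rewrite gg_mulG subnK.
exact: prodvSr.
Qed.

Section Strings.

Variables (l : A) (s : seq (A * (nat * nat))).
Hypotheses (lG : l \in G 1%N).
Hypothesis s_string : forall v p nu, (v, (p, nu)) \in s ->
  [/\ (0 < p)%N, v \in G nu & l ^+ p * v = 0].
Hypothesis s_basis : basis_of fullv
  (flatten [seq [seq l ^+ a * w.1 | a <- iota 0 w.2.1] | w <- s]).

Let slice i a : seq A :=
  [seq l ^+ (i + a - w.2.2) * w.1 | w <- s & covers i a w.2].

Lemma slice_free i a : free (slice i a).
Proof.
have := basis_free s_basis; set B := flatten _ => freeB.
have sub_B : subseq (slice i a) B.
  rewrite /slice /B; elim: (s) => //= w t IH; case: ifP => [/andP[cov1 cov2]|_].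
    rewrite map_cons -cat1s; apply: cat_subseq => //.
    rewrite sub1seq; apply/mapP; exists (i + a - w.2.2)%N => //.
    by rewrite mem_iota; move: cov1 cov2; lia.
  by rewrite -[X in subseq X]cat0s; apply: cat_subseq => //; apply: sub0seq.
by have /subseq_uniqP-> := sub_B; rewrite ?filter_free ?free_uniq.
Qed.

Lemma slice_sub i a : (<<slice i a>> <= G (i + a)%N)%VS.
Proof.
apply/span_subvP => _ /mapP[[v [p nu]] + ->] /=;
  rewrite mem_filter => /andP[/andP[/= cov1 cov2]].
move=> /s_string[_ vG _]; have {2}-> : (i + a = i + a - nu + nu)%N by lia.
by apply: gg_mul => //; apply: gg_exp.
Qed.

(** Every element of the string basis is homogeneous and the degrees are in
direct sum, so the expansion of a homogeneous element only involves basis elements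
of its own degree. *)
Lemma slice_span i : <<slice i 0>>%VS = G i.
Proof.
have [i_gt|i_le] := ltnP j i.
  by apply/eqP; rewrite gg_above // -subv0 -(gg_above i_gt) -{2}[i]addn0 slice_sub.
apply/eqP; rewrite eqEsubv -{2}[i]addn0 slice_sub; apply/subvP => x xG.
have full : (fullv <= \sum_(d < j.+1) <<slice d 0>>)%VS.
  rewrite -(span_basis s_basis); apply/span_subvP => y y_in.
  have y_neq0 : y != 0 by apply: basis_not0 s_basis y_in.
  have /flatten_mapP[[v [p nu]] w_in /mapP[a]] := y_in.
  rewrite mem_iota add0n /= => a_lt Dy.
  have y_slice : y \in slice (nu + a) 0.
    apply/mapP; exists (v, (p, nu)); last by rewrite Dy addn0 addKn.
    by rewrite mem_filter w_in /covers /= leq_addr addn0 ltn_add2l a_lt.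
  have d_le : (nu + a < j.+1)%N.
    rewrite ltnNge; apply: contra y_neq0 => d_gt; rewrite -memv0 -(gg_above d_gt).
    by rewrite -[(nu + a)%N]addn0; apply: (subvP (slice_sub _ _)); apply: memv_span.
  apply: subvP (memv_span y_slice); exact: (sumv_sup (Ordinal d_le)).
have /memv_sumP[xs xs_in Dx] := subvP full x (memvf x).
have xs_eq : [forall (d : 'I_j.+1 | true), xs d == if d == i :> nat then x else 0].
  have := gg_direct gg => /directv_sum_unique <-.
  - rewrite -Dx (bigD1 (Ordinal (i_le : i < j.+1)%N)) //= eqxx big1 ?addr0 // =>
      d /negbTE d_neq.
    by rewrite -[d == i :> nat]/(d == Ordinal (i_le : i < j.+1)%N) d_neq.
  - by move=> d _; rewrite -[(d : nat)]addn0; apply: (subvP (slice_sub _ _)); apply: xs_in.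
  - by move=> d _; case: eqP => [->//|_]; apply: mem0v.
have /forallP/(_ (Ordinal (i_le : i < j.+1)%N)) := xs_eq; rewrite /= eqxx => /eqP <-.
exact: xs_in.
Qed.

(** Multiplication by l^a moves each string along itself: a basis element in
degree i goes to the basis element a steps further, or to 0 beyond the end. *)
Lemma rank_slice i a : (G i * <[l ^+ a]>)%VS = <<slice i a>>%VS.
Proof.
rewrite -slice_span; apply/eqP; rewrite eqEsubv; apply/andP; split.
  rewrite -limg_amulr limg_span; apply/span_subvP => _ /mapP[x /mapP[[v [p nu]] + ->] ->].
  rewrite mem_filter /covers addn0 /= => /andP[/andP[nu_le p_gt] w_in].
  rewrite lfunE /= [X in X \in _](gg_mulC gg) mulrA -exprD.
  have [cov|cov] := ltnP (i + a) (nu + p).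
    apply: memv_span; apply/mapP; exists (v, (p, nu)) => /=.
      by rewrite mem_filter /covers nu_le cov w_in.
    by congr (_ ^+ _ * _); lia.
  have [_ _ lpv0] := s_string w_in.
  have -> : (a + (i - nu) = (a + (i - nu) - p) + p)%N by lia.
  by rewrite exprD -mulrA lpv0 mulr0 mem0v.
apply/span_subvP => _ /mapP[[v [p nu]] + ->].
rewrite mem_filter => /andP[/andP[/= nu_le p_gt] w_in].
have -> : l ^+ (i + a - nu) * v = (l ^+ (i - nu) * v) * l ^+ a.
  by rewrite [RHS](gg_mulC gg) mulrA -exprD; congr (_ ^+ _ * _); lia.
rewrite memv_mul ?memv_line // memv_span //; apply/mapP; exists (v, (p, nu)) => //=.
  by rewrite mem_filter w_in /covers /= nu_le; lia.
by rewrite addn0.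
Qed.

End Strings.

Lemma nstr_rank l (D : {mset nat * nat}) i a : l \in G 1%N -> is_JDT G l D ->
  nstr D i a = \dim (G i * <[l ^+ a]>)%VS.
Proof.
move=> lG [s [s_string s_basis ->]]; rewrite nstr_seq_mset.
rewrite (rank_slice lG s_string s_basis) (eqP (slice_free lG s_basis i a)).
by rewrite size_map size_filter /nstr count_map.
Qed.

End Graded.

Lemma Gor_dim3 (K : fieldType) (A : falgType K)
    (pi : {lrmorphism {mpoly K[3]} -> A}) k d : Gor pi (T131 k) -> (0 < d < k.+1)%N ->
      \dim (Adeg pi d) = 3%N.
Proof.
move=> [_ _ ->]; case: d => // d; rewrite andTb ltnS => d_lt.
by rewrite /T131 /= nth_rcons size_nseq d_lt nth_nseq d_lt.
Qed.

(** * A linear form that is bijective in the middle degrees *)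

Section Nonzerodivisor.

Variables (K : fieldType) (A : falgType K) (G : nat -> {vspace A}) (j : nat).
Hypotheses (gg : graded_gorenstein G j) (j_gt2 : (2 < j)%N) (two_neq0 : 2%:R != 0 :> K).
Hypotheses (dim1 : \dim (G 1%N) = 3%N) (dim2 : \dim (G 2) = 3%N).

Lemma mul_line_dim (U : {vspace A}) v :
  (\dim (U :&: lker (amulr v)) + \dim (U * <[v]>))%N = \dim U.
Proof. by rewrite -limg_amulr limg_ker_dim. Qed.

Lemma mem_ker (U : {vspace A}) v z :
  (z \in U :&: lker (amulr v))%VS = (z \in U) && (z * v == 0).
Proof. by rewrite memv_cap memv_ker lfunE. Qed.

Lemma mul_line_inj (U : {vspace A}) v :
  {in U, forall z, z * v = 0 -> z = 0} -> \dim (U * <[v]>) = \dim U.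
Proof.
move=> inj; rewrite -(mul_line_dim U v) (_ : (_ :&: _)%VS = 0%VS) ?dimv0 //.
apply/eqP; rewrite -subv0; apply/subvP => z; rewrite mem_ker memv0 => /andP[zU /eqP zv0].
by rewrite (inj z).
Qed.

Lemma mul_line_ker (U : {vspace A}) v : (\dim (U * <[v]>) < \dim U)%N ->
  exists2 z, z \in U & z != 0 /\ z * v = 0.
Proof.
move=> lt_dim; set N := (U :&: lker (amulr v))%VS.
have N_neq0 : vpick N != 0 by rewrite vpick0 -dimv_eq0; have := mul_line_dim U v;
  rewrite -/N; lia.
by have := memv_pick N; rewrite mem_ker => /andP[zU /eqP]; exists (vpick N).
Qed.

Let sub_degree2 u : u \in G 1%N -> (G 1%N * <[u]> <= G 2)%VS.
Proof. by move=> uG; rewrite -[2%N]/(1 + 1)%N -(gg_mulG gg) prodvSr. Qed.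

Let iso_or_kernel u : u \in G 1%N ->
  (G 1%N * <[u]> = G 2)%VS \/ (exists2 z, z \in G 1%N & z != 0 /\ z * u = 0).
Proof.
move=> uG; have [dim_ge|] := leqP 3 (\dim (G 1%N * <[u]>)).
  by left; apply/eqP; rewrite eqEdim sub_degree2 // dim2.
by rewrite -dim1 => /mul_line_ker; right.
Qed.

Lemma dim_line2 (e g : A) : (\dim (<[e]> + <[g]>) <= 2)%N.
Proof.
by have [+ _] := dimv_add_leqif <[e]>%VS <[g]>%VS; rewrite !dim_vline;
  do 2!case: (_ != 0); lia.
Qed.

Lemma plane_basis (N : {vspace A}) x y : \dim N = 2%N -> x \in N -> y \in N ->
    x != 0 -> y \notin <[x]>%VS -> forall n, n \in N -> exists a b, n = a *: x + b *: y.
Proof.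
move=> dimN xN yN x_neq0 y_notin n nN.
have free_yx : free [:: y; x] by rewrite free_cons span_seq1 y_notin seq1_free.
have: N = <<[:: y; x]>>%VS.
  apply/esym/eqP; rewrite eqEdim dimN (eqP free_yx) leqnn andbT.
  by apply/span_subvP => z; rewrite !inE => /orP[] /eqP ->.
rewrite span_cons span_seq1 => N_eq; move: nN.
by rewrite N_eq => /memv_addP[_ /vlineP[b ->] [_ /vlineP[a ->] ->]]; exists a, b;
  rewrite addrC.
Qed.

Lemma not_all_line (N : {vspace A}) x : (1 < \dim N)%N ->
  exists2 y, y \in N & y \notin <[x]>%VS.
Proof.
move=> dimN; apply/subvPn; apply: contraL dimN => /dimvS; rewrite dim_vline; lia.
Qed.

Section RankOne.

Variables (v w : A).
Hypotheses (vG : v \in G 1%N) (rank_v : (\dim (G 1%N * <[v]>) <= 1)%N).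
Hypotheses (wG : w \in G 1%N) (wv_neq0 : w * v != 0).

Let N := (G 1%N :&: lker (amulr v))%VS.

Let mC := gg_mulC gg.

Let line z : z \in G 1%N -> exists c, z * v = c *: (w * v).
Proof.
move=> zG; apply/vlineP; have -> : (<[w * v]> = G 1%N * <[v]>)%VS.
  apply/eqP; rewrite eqEdim dim_vline wv_neq0 rank_v andbT -memvE.
  by rewrite memv_mul ?memv_line.
by rewrite memv_mul ?memv_line.
Qed.

Let dimN : \dim N = 2%N.
Proof.
have := mul_line_dim (G 1%N) v; rewrite dim1 -/N.
have -> : \dim (G 1%N * <[v]>) = 1%N; last lia.
apply/eqP; rewrite eqn_leq rank_v lt0n dimv_eq0 -subv0; apply/subvPn.
by exists (w * v); rewrite ?memv0 // memv_mul ?memv_line.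
Qed.

Let split z : z \in G 1%N -> exists c n, n \in N /\ z = c *: w + n.
Proof.
move=> zG; have [c zv] := line zG; exists c, (z - c *: w); split;
  last by rewrite addrC subrK.
by rewrite mem_ker memvB ?memvZ //= mulrBl -scalerAl zv subrr.
Qed.

Let NG n : n \in N -> n \in G 1%N. Proof. by rewrite mem_ker => /andP[]. Qed.
Let Nv n : n \in N -> n * v = 0. Proof. by rewrite mem_ker => /andP[_ /eqP]. Qed.

Let wwv_neq0 : w * (w * v) != 0.
Proof.
apply: contra wv_neq0 => /eqP wwv0; apply/eqP.
apply: (gg_socle gg) (gg_mul gg wG vG) _ => //.
move=> z /split[c [n [nN ->]]]; rewrite mulrDl -scalerAl wwv0 scaler0 add0r.
by rewrite mulrA (mC n) -mulrA Nv // mulr0.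
Qed.

Let no_plane (e g : A) : ~ (G 2 <= <[e]> + <[g]>)%VS.
Proof. by move=> /dimvS; rewrite dim2; have := dim_line2 e g; lia. Qed.

Let deg2E e g : (forall x y, x \in G 1%N -> y \in G 1%N ->
  x * y \in (<[e]> + <[g]>)%VS) -> False.
Proof.
by move=> H; apply: (@no_plane e g); rewrite -[2%N]/(1 + 1)%N -(gg_mulG gg); apply/prodvP.
Qed.

(** Let N = <u, v> be the kernel of v in A_1 and w a complement.  If
neither w + u nor w - u were injective on A_1, then wu + uu and wu - uu would be
multiples of wv, hence so would wu and uu, and A_2 would be spanned by wv and ww. *)
Lemma rank_one_nilpotent : v * v = 0 -> v != 0 ->
  exists2 u, u \in G 1%N & (G 1%N * <[u]> = G 2)%VS.
Proof.
move=> vv0 v_neq0; have vN : v \in N by rewrite mem_ker vG vv0 eqxx.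
have [u uN u_notin] : exists2 u, u \in N & u \notin <[v]>%VS by apply: not_all_line;
  rewrite dimN.
have uG := NG uN; have uv0 := Nv uN; have Nbasis := plane_basis dimN vN uN v_neq0 u_notin.
have sign_case (s : K) : s != 0 -> (exists2 u, u \in G 1%N & (G 1%N * <[u]> = G 2)%VS) \/
    exists c, w * u + s *: (u * u) = c *: (w * v).
  move=> s_neq0; have wsuG : w + s *: u \in G 1%N by rewrite memvD ?memvZ.
  have [iso|[z zG [z_neq0 z0]]] := iso_or_kernel wsuG; first by left; exists (w + s *: u).
  right; rewrite (mC z) in z0; have [c [n [nN Dz]]] := split zG;
    have [b [a Dn]] := Nbasis n nN.
  have c0 : c = 0.
    apply/eqP; apply: contraTT isT => c_neq0; case/negP: wwv_neq0.
    have : c *: (w * (w * v)) == 0; last by rewrite scaler_eq0 (negbTE c_neq0).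
    have zv : z * v = c *: (w * v) by rewrite Dz mulrDl (Nv nN) addr0 scalerAl.
    have uwv : u * (w * v) = 0 by rewrite mulrA (mC u) -mulrA uv0 mulr0.
    have := congr1 (fun t => t * v) z0;
      rewrite /= mul0r -mulrA zv -scalerAr mulrDl -scalerAl.
    by rewrite uwv scaler0 addr0 => ->.
  move: Dz; rewrite c0 scale0r add0r Dn => Dz.
  have a_neq0 : a != 0.
    apply: contraNneq z_neq0 => a0; move: z0; rewrite Dz a0 scale0r addr0.
    rewrite -scalerAr mulrDl -scalerAl uv0 scaler0 addr0 => /eqP.
    by rewrite scaler_eq0 (negbTE wv_neq0) orbF => /eqP->; rewrite scale0r.
  exists (- (b / a)); apply: (scalerI a_neq0); move: z0; rewrite Dz.
  rewrite mulrDr -!scalerAr !mulrDl -!scalerAl uv0 scaler0 addr0 addrC => /eqP.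
  by rewrite addr_eq0 => /eqP ->; rewrite scalerA mulrN mulrCA divff // mulr1 scaleNr.
have [//|[c1 E1]] := @sign_case 1 (oner_neq0 _).
have neg1_neq0 : -1 != 0 :> K by rewrite oppr_eq0 oner_eq0.
have [//|[c2 E2]] := sign_case _ neg1_neq0.
rewrite scale1r in E1; rewrite scaleN1r in E2.
have wu_line : w * u \in <[w * v]>%VS.
  apply/vlineP; exists ((c1 + c2) / 2%:R).
  apply: (scalerI two_neq0); rewrite scalerA mulrCA divff // mulr1 [RHS]scalerDl -E1 -E2.
  by rewrite addrACA subrr addr0 scaler_nat.
have uu_line : u * u \in <[w * v]>%VS.
  have -> : u * u = c1 *: (w * v) - w * u by rewrite -E1 addrAC subrr add0r.
  by rewrite memvB ?memvZ ?memv_line.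
case: (@deg2E (w * v) (w * w)) => x y xG yG.
have [c [n [nN ->]]] := split xG; have [c' [n' [n'N ->]]] := split yG.
have NN : n * n' \in <[w * v]>%VS.
  have [b [a ->]] := Nbasis n nN; have [b' [a' ->]] := Nbasis n' n'N.
  rewrite mulrDl !mulrDr -!scalerAl -!scalerAr vv0 (mC v u) uv0 !scaler0 !add0r.
  by rewrite !memvZ.
have wN m : m \in N -> w * m \in <[w * v]>%VS.
  move=> mN; have [b [a ->]] := Nbasis m mN.
  by rewrite mulrDr -!scalerAr memvD ?memvZ ?memv_line.
rewrite mulrDl !mulrDr -!scalerAl -!scalerAr (mC n w).
have sub_e := subvP (addvSl <[w * v]>%VS <[w * w]>%VS).
apply: memvD; apply: memvD; rewrite ?memvZ //.
- by apply: (subvP (addvSr _ _)); apply: memv_line.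
- by apply/sub_e/wN.
- by apply/sub_e/wN.
- exact: sub_e.
Qed.

(** Here v itself serves as the linear form w with wv <> 0.  Now A_1 is
the sum of the line of v and of the kernel N = <x, y> of v, and v + n is injective
on A_1 as soon as n is a nonzerodivisor on N.  If none of x, y, x + y were, the three relations obtained would make all the products of
elements of N multiples of one element g, and A_2 would be spanned by vv and g. *)
Lemma rank_one_idempotent : w = v ->
  exists2 u, u \in G 1%N & (G 1%N * <[u]> = G 2)%VS.
Proof.
move=> wvE; have vvv_neq0 : v * (v * v) != 0 by rewrite -{1 2}wvE.
have vsplit := split; rewrite wvE in vsplit.
have N_case n : n \in N -> (exists2 u, u \in G 1%N & (G 1%N * <[u]> = G 2)%VS) \/
    exists n', [/\ n' \in N, n' != 0 & n' * n = 0].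
  move=> nN; have vnG : v + n \in G 1%N by rewrite memvD // NG.
  have [iso|[z zG [z_neq0 z0]]] := iso_or_kernel vnG; first by left; exists (v + n).
  right; have [c [n' [n'N Dz]]] := vsplit _ zG; exists n'.
  have zv : z * v = c *: (v * v) by rewrite Dz mulrDl (Nv n'N) addr0 scalerAl.
  have c0 : c = 0.
    apply/eqP; apply: contraTT isT => c_neq0; case/negP: vvv_neq0.
    have : c *: (v * (v * v)) == 0; last by rewrite scaler_eq0 (negbTE c_neq0).
    have := congr1 (fun t => t * v) z0; rewrite /= mul0r (mC z) -mulrA zv -scalerAr mulrDl.
    by rewrite [n * _]mulrA (Nv nN) mul0r addr0 => ->.
  rewrite c0 scale0r add0r in Dz; rewrite -Dz z_neq0 Dz; split=> //.
  by move: z0; rewrite Dz mulrDr (Nv n'N) add0r.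
have N_gt0 : (0 < \dim N)%N by rewrite dimN.
have x_neq0 : vpick N != 0 by rewrite vpick0 -dimv_eq0 dimN.
have xN := memv_pick N; set x := vpick N in x_neq0 xN.
have [y yN y_notin] : exists2 y, y \in N & y \notin <[x]>%VS by apply: not_all_line;
  rewrite dimN.
have Nbasis := plane_basis dimN xN yN x_neq0 y_notin.
have [//|[x' [x'N x'_neq0 xx']]] := N_case _ xN.
have [//|[y' [y'N y'_neq0 yy']]] := N_case _ yN.
have [//|[t [tN t_neq0 xyt]]] := N_case _ (memvD xN yN).
have [a [b Dx']] := Nbasis _ x'N; have [c [d Dy']] := Nbasis _ y'N.
have [e [f Dt]] := Nbasis _ tN.
have [g g_line] : exists g, [/\ x * x \in <[g]>%VS,
  x * y \in <[g]>%VS & y * y \in <[g]>%VS].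
  have Ex : a *: (x * x) + b *: (x * y) = 0.
    by rewrite -xx' Dx' mulrDl -!scalerAl (mC y).
  have Ey : c *: (x * y) + d *: (y * y) = 0.
    by rewrite -yy' Dy' mulrDl -!scalerAl.
  have Et : x * y = 0 -> e *: (x * x) + f *: (y * y) = 0.
    move=> xy0; rewrite -xyt Dt mulrDl !mulrDr -!scalerAl (mC y) xy0 !scaler0 addr0.
    by rewrite add0r.
  have solve (p q : K) (X Y : A) : p != 0 -> p *: X + q *: Y = 0 -> X \in <[Y]>%VS.
    move=> p_neq0 /eqP; rewrite addr_eq0 => /eqP pX; apply/vlineP; exists (- (q / p)).
    apply: (scalerI p_neq0); rewrite pX scalerA mulrN mulrCA divff // mulr1 scaleNr //.
  have xy0_case : x * y = 0 -> exists g, [/\ x * x \in <[g]>%VS,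
    x * y \in <[g]>%VS & y * y \in <[g]>%VS].
    move=> xy0; have [e0|e_neq0] := eqVneq e 0; last first.
      by exists (y * y); rewrite memv_line xy0 mem0v (solve _ _ _ _ e_neq0 (Et xy0)).
    have f_neq0 : f != 0.
      by apply: contraNneq t_neq0 => f0; rewrite Dt e0 f0 !scale0r addr0.
    exists (x * x); rewrite memv_line xy0 mem0v (solve f e) //.
    by rewrite addrC Et.
  have [a0|a_neq0] := eqVneq a 0.
    apply: xy0_case; move: Ex; rewrite a0 scale0r add0r => /eqP; rewrite scaler_eq0.
    case/orP=> [/eqP b0|/eqP //]; case/eqP: x'_neq0.
    by rewrite Dx' a0 b0 !scale0r addr0.
  have [d0|d_neq0] := eqVneq d 0.
    apply: xy0_case; move: Ey; rewrite d0 scale0r addr0 => /eqP; rewrite scaler_eq0.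
    case/orP=> [/eqP c0|/eqP //]; case/eqP: y'_neq0.
    by rewrite Dy' d0 c0 !scale0r addr0.
  exists (x * y); rewrite memv_line (solve _ _ _ _ a_neq0 Ex) (solve d c) //.
  by rewrite addrC.
case: g_line => xx_g xy_g yy_g.
(* For z = c1 v + n and z' = c2 v + n' the product is c1 c2 vv + n n'. *)
case: (@deg2E (v * v) g) => z z' zG z'G.
have [c1 [n [nN ->]]] := vsplit _ zG; have [c2 [n' [n'N ->]]] := vsplit _ z'G.
rewrite mulrDl !mulrDr -!scalerAl -!scalerAr (mC v n') (Nv nN) (Nv n'N) !scaler0 addr0
  add0r.
apply: memv_add; first by rewrite !memvZ ?memv_line.
have [p [q ->]] := Nbasis n nN; have [p' [q' ->]] := Nbasis n' n'N.
rewrite mulrDl !mulrDr -!scalerAl -!scalerAr (mC y x).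
by apply: memvD; apply: memvD; rewrite !memvZ.
Qed.

End RankOne.

Lemma rank_one_iso v : v \in G 1%N -> v != 0 -> (\dim (G 1%N * <[v]>) <= 1)%N ->
  exists2 u, u \in G 1%N & (G 1%N * <[u]> = G 2)%VS.
Proof.
move=> vG v_neq0 rank_v; have [vv0|vv_neq0] := eqVneq (v * v) 0; last first.
  exact: (rank_one_idempotent vG rank_v vG vv_neq0 (erefl v)).
have [w wG wv_neq0] : exists2 w, w \in G 1%N & w * v != 0.
  have: ((G 1%N * <[v]>)%VS != 0%VS).
    apply: contra v_neq0 => /eqP Gv0; apply/eqP; apply: (gg_socle gg _ vG) => [|y yG];
      first lia.
    by apply/eqP; rewrite -memv0 -Gv0 memv_mul ?memv_line.
  rewrite -vpick0 => pick_neq0.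
  by have /memv_cosetP[w wG Dw] := memv_pick (G 1%N * <[v]>); exists w; rewrite -?Dw.
exact: rank_one_nilpotent vG rank_v wG wv_neq0 vv0 v_neq0.
Qed.

Hypothesis j_gt3 : (3 < j)%N.
Hypothesis dim3 : \dim (G 3) = 3%N.

(** In the quotient by v, degree 2 has dimension at most 1.  It is
then zero or spanned by a square yy, as the squares span A_2; in the second case
zy is a multiple of yy for every linear z, so degree 3 is spanned by yyy and v
has rank at least 2 on A_2. *)
Lemma macaulay_bound v : v \in G 1%N -> (2 <= \dim (G 1%N * <[v]>))%N ->
  (2 <= \dim (G 2 * <[v]>))%N.
Proof.
move=> vG rank_v; set W := (G 1%N * <[v]>)%VS; have mC := gg_mulC gg.
rewrite leqNgt; apply/negP => rank_lt.
have G1W x z : x \in G 1%N -> z \in W -> x * z \in (G 2 * <[v]>)%VS.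
  by move=> xG zW; rewrite -[2%N]/(1 + 1)%N -(gg_mulG gg) -prodvA memv_mul.
have sq_in y : y \in G 1%N -> y * y \in W.
  move=> yG; apply/negPn/negP => yy_notin.
  have yyG : y * y \in G 2 := gg_mul gg yG yG.
  have G2E : (<[y * y]> + W)%VS = G 2.
    apply/eqP; rewrite eqEdim subv_add sub_degree2 // -memvE yyG dim2.
    rewrite dimv_disjoint_sum ?dim_vline; last first.
      apply/eqP; rewrite -subv0; apply/subvP => _ /memv_capP[/vlineP[c ->] cyyW].
      rewrite memv0; apply: contraR yy_notin; rewrite scaler_eq0 negb_or => /andP[c_neq0 _].
      by rewrite -[y * y](scalerK c_neq0) memvZ.
    by have -> : y * y != 0 by apply: contraNneq yy_notin => ->; apply: mem0v.
  have xyy x : x \in G 1%N -> x * (y * y) \in (<[y * (y * y)]> + G 2 * <[v]>)%VS.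
    move=> xG; have : x * y \in (<[y * y]> + W)%VS by rewrite G2E; apply: (gg_mul gg xG yG).
    case/memv_addP => _ /vlineP[b ->] [w wW xyE].
    rewrite mulrA xyE mulrDl -scalerAl -mulrA (mC w) memv_add ?memvZ ?memv_line //.
    exact: G1W.
  have: (G 3 <= <[y * (y * y)]> + G 2 * <[v]>)%VS.
    rewrite -[3%N]/(1 + 2)%N -(gg_mulG gg) -{1}G2E; apply/prodvP => x t xG.
    case/memv_addP => _ /vlineP[b ->] [w wW ->]; rewrite mulrDr -scalerAr.
    apply: memvD; first by apply: memvZ; apply: xyy.
    by apply: (subvP (addvSr _ _)); apply: G1W.
  move/dimvS; rewrite dim3.
  have [+ _] := dimv_add_leqif <[y * (y * y)]>%VS (G 2 * <[v]>)%VS.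
  rewrite dim_vline => le le3.
  have rank_le1 : (\dim (G 2 * <[v]>) <= 1)%N := rank_lt.
  by have := leq_trans le3 (leq_trans le (leq_add (leq_b1 _) rank_le1)).
have prod_in x y : x \in G 1%N -> y \in G 1%N -> x * y \in W.
  move=> xG yG; rewrite -[x * y](scalerK two_neq0) memvZ //.
  have -> : 2%:R *: (x * y) = (x + y) * (x + y) - x * x - y * y.
    rewrite mulrDl !mulrDr (mC y x) [x * x + _]addrC addrACA -[RHS]addrA -opprD addrK.
    by rewrite scaler_nat.
  by rewrite !memvB ?sq_in ?memvD.
have G2W : (G 2 <= W)%VS by rewrite -[2%N]/(1 + 1)%N -(gg_mulG gg); apply/prodvP.
have: (G 3 <= G 2 * <[v]>)%VS.
  by rewrite -[3%N]/(1 + 2)%N -(gg_mulG gg); apply/prodvP => x t xG /(subvP G2W);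
    apply: G1W.
by move/dimvS; rewrite dim3 => /leq_ltn_trans/(_ rank_lt).
Qed.

(** If uv = 0 then v kills uA_1 inside A_2, so the ranks of u on A_1 and of v on
A_2 add up to at most 3; by Macaulay's bound the ranks of u and v on A_1 cannot both
be at least 2. *)
Lemma exists_iso : exists2 u, u \in G 1%N & (G 1%N * <[u]> = G 2)%VS.
Proof.
pose u := vpick (G 1%N); have uG : u \in G 1%N := memv_pick _.
have u_neq0 : u != 0 by rewrite vpick0 -dimv_eq0 dim1.
have [iso|[v vG [v_neq0 vu0]]] := iso_or_kernel uG; first by exists u.
have [rank_u|rank_u] := leqP (\dim (G 1%N * <[u]>)) 1; first exact: rank_one_iso rank_u.
have [rank_v|rank_v] := leqP (\dim (G 1%N * <[v]>)) 1; first exact: rank_one_iso rank_v.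
have := macaulay_bound vG rank_v; have := mul_line_dim (G 2) v; rewrite dim2.
suff: (\dim (G 1%N * <[u]>) <= \dim (G 2 :&: lker (amulr v)))%N by lia.
apply/dimvS/prodvP => x _ xG /vlineP[c ->]; rewrite mem_ker -scalerAr -scalerAl -mulrA.
rewrite (gg_mulC gg u) vu0 mulr0 scaler0 eqxx andbT memvZ //.
exact: (gg_mul gg xG uG).
Qed.

End Nonzerodivisor.

Section Table.

Variables (K : fieldType) (A : falgType K) (G : nat -> {vspace A}) (j : nat).
Hypotheses (gg : graded_gorenstein G j) (two_neq0 : 2%:R != 0 :> K).
Hypotheses (dimG : forall d, (0 < d < j)%N -> \dim (G d) = 3%N).
Variable l : A.
Hypotheses (lG : l \in G 1%N) (l_neq0 : l != 0).

Let rho a := \dim (G 1%N * <[l ^+ a]>).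
Let sigma a := nat_of_bool (l ^+ a != 0).

(** Multiplication by u identifies A_i with A_(i+1) and commutes with l^a. *)
Lemma middle_rank i a : (3 < j)%N -> (0 < i)%N -> (i + a < j)%N ->
  \dim (G i * <[l ^+ a]>)%VS = rho a.
Proof.
move=> j_gt3 i_gt0 ia_lt.
have [u uG u_iso] : exists2 u, u \in G 1%N & (G 1%N * <[u]> = G 2)%VS.
  by apply: (exists_iso gg _ two_neq0) => //; try apply: dimG; lia.
have isoG d : (0 < d)%N -> (G d * <[u]>)%VS = G d.+1.
  case: d => // d _; rewrite -[d.+1]addn1 -(gg_mulG gg) -prodvA u_iso (gg_mulG gg).
  by congr G; lia.
elim: i i_gt0 ia_lt => // -[|i] IH _ ia_lt //.
rewrite -IH //; last by lia.
rewrite -isoG // -prodvA prodv_line (gg_mulC gg u) -prodv_line prodvA.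
set U := (G i.+1 * <[l ^+ a]>)%VS.
have U_sub : (U <= G (i.+1 + a)%N)%VS.
  by rewrite -(gg_mulG gg) prodvSr // -memvE (gg_exp gg).
apply: mul_line_inj => z /(subvP U_sub) zG zu0; apply/eqP/negPn/negP => z_neq0.
have ker : z \in (G (i.+1 + a)%N :&: lker (amulr u))%VS by rewrite mem_ker zG zu0 eqxx.
have := mul_line_dim (G (i.+1 + a)%N) u; rewrite isoG // !dimG; try lia.
suff: (0 < \dim (G (i.+1 + a) :&: lker (amulr u)))%N by lia.
by rewrite lt0n dimv_eq0 -subv0; apply/subvPn; exists z; rewrite ?memv0.
Qed.

Lemma nstr_table (D : {mset nat * nat}) : (2 <= j)%N -> is_JDT G l D ->
  has_table D j rho sigma.
Proof.
move=> j2 JD i a; rewrite (nstr_rank gg _ _ lG JD).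
have laG := gg_exp gg a lG.
case: ltnP => ia_le.
  apply/eqP; rewrite dimv_eq0 -subv0 -(gg_above gg ia_le) -(gg_mulG gg); exact: prodvSr.
case: (eqVneq i 0%N) => [->|i_neq0] /=; first by rewrite (gg_deg0 gg) prod1v dim_vline.
case: (eqVneq (i + a)%N j) => [ia_j|ia_neq].
  have -> : i = (j - a)%N by lia.
  by rewrite (gg_pairing gg) //; lia.
have [j4|j_le] := ltnP 3 j; first by apply: middle_rank; lia.
have [->//|[Di Da]] : i = 1%N \/ i = 2 /\ a = 0%N by lia.
by rewrite /rho Di Da expr0 !prodv1 !dimG; lia.
Qed.

(** The stabilization argument for j >= 4: if l^a A_2 = l^(a+1) A_1, then
multiplying by A_1 repeatedly gives l^a A_(j-a) = l^(j-1) A_1.  The left-hand side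
is A_j when l^a is nonzero, so l^(j-1) is nonzero. *)
Lemma jdt_classified (D : {mset nat * nat}) : is_JDT G l D ->
  [/\ j = 2 -> D = jdt1 2 \/ D = jdt8 2, j = 3%N -> D \in rcons (jdts 3) jdt9
    & (3 < j)%N -> D \in jdts j].
Proof.
move=> JD.
have Dgt0 : {in D, forall w, (0 < w.1)%N}.
  have [s [s_string _ ->]] := JD.
  apply/allP; rewrite (perm_all _ (perm_eq_seq_mset _));
    apply/allP => _ /mapP[[v [p nu]] w_in ->].
  by have [] := s_string _ _ _ w_in.
have sigma0 : sigma 0 = 1%N by rewrite /sigma expr0 oner_neq0.
have sigma1 : sigma 1 = 1%N by rewrite /sigma expr1 l_neq0.
have rho0 : (1 < j)%N -> rho 0 = 3%N by move=> j_gt1;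
  rewrite /rho expr0 prodv1 dimG // j_gt1.
have sigma_rho a : (a.+2 <= j)%N -> (0 < sigma a)%N = (0 < rho a)%N.
  move=> a_lt; rewrite /sigma lt0b lt0n dimv_eq0; congr (~~ _).
  apply/eqP/eqP => [->|G1la]; first by rewrite prodv0.
  apply: (gg_socle gg) (gg_exp gg a lG) _; first lia.
  by move=> y yG; apply/eqP; rewrite -memv0 -G1la memv_mul ?memv_line.
split=> j_case.
- have j_gt1 : (1 < j)%N by rewrite j_case.
  by apply: (classify2 Dgt0 (nstr_table j_gt1 JD)) => //; apply: rho0.
- have j_gt1 : (1 < j)%N by rewrite j_case.
  apply: (classify3 Dgt0 (nstr_table j_gt1 JD)) => //; first exact: rho0.
  by rewrite -sigma_rho ?sigma1 ?j_case.
have j_gt1 : (1 < j)%N by lia.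
apply: (classify4 Dgt0 (nstr_table j_gt1 JD)) => //; first exact: rho0.
move=> a a_lt rho_gt0 rho_eq; rewrite lt0b.
have G2la : (G 2 * <[l ^+ a]> = G 1%N * <[l ^+ a.+1]>)%VS.
  apply/eqP; rewrite eq_sym eqEdim middle_rank //.
  rewrite -/(rho _) rho_eq leqnn andbT exprS -prodv_line prodvA prodvSl //.
  by rewrite -[2%N]/(1 + 1)%N -(gg_mulG gg) prodvSr.
have Gmla m : (G m.+2 * <[l ^+ a]> = G 1%N * <[l ^+ (m + a).+1]>)%VS.
  elim: m => // m IH; rewrite (gg_degS gg) -prodvA IH prodvA (gg_mulG gg).
  have -> : (l ^+ (m.+1 + a).+1 = l ^+ a.+1 * l ^+ m.+1) by rewrite -exprD;
    congr (_ ^+ _); lia.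
  rewrite -prodv_line prodvA -G2la -prodvA prodv_line -exprD.
  by congr (_ * <[_ ^+ _]>)%VS; lia.
apply: contraTneq rho_gt0 => lj0; rewrite -leqNgt leqn0 dimv_eq0.
suff -> : l ^+ a = 0 by rewrite prodv0.
have la_G := gg_exp gg a lG; have a_le : (a <= j)%N by lia.
have: \dim (G (j - a) * <[l ^+ a]>)%VS = 0%N.
  have -> : (j - a = (j - a - 2).+2)%N by lia.
  rewrite Gmla; have -> : ((j - a - 2 + a).+1 = j.-1)%N by lia.
  by rewrite lj0 prodv0 dimv0.
by rewrite (gg_pairing gg a_le la_G); case: eqP.
Qed.

End Table.

(** * Gorenstein quotients from a grading *)

Lemma mpoly_eval (K : fieldType) (A : falgType K) (h : 'I_3 -> A) :
  (forall x y : A, x * y = y * x) ->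
  exists pi : {lrmorphism {mpoly K[3]} -> A}, forall i, pi 'X_i = h i.
Proof.
move=> mC; pose f := mmap (in_alg A) h.
have fZ : linear f.
  by move=> c p q; rewrite /f mmapD mmapZ /= mulr_algl.
have fM : monoid_morphism f.
  have [fM f1] : multiplicative f by apply: commr_mmap_is_multiplicative => *; apply: mC.
  by split.
pose fL := GRing.isLinear.Build _ _ _ _ f fZ.
pose fR := GRing.isMonoidMorphism.Build _ _ f fM.
pose F : {lrmorphism {mpoly K[3]} -> A} := HB.pack f fL fR.
by exists F => i; rewrite /= /f mmapX mmap1U.
Qed.

Section Grading.

Variables (K : fieldType) (A : falgType K) (k : nat) (x : 'I_3 -> A).
Variables (G : nat -> {vspace A}) (pr : nat -> A -> A).
Hypothesis mC : forall a b : A, a * b = b * a.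
Hypotheses (G0 : G 0%N = 1%VS) (G1 : G 1%N = <<[seq x i | i : 'I_3]>>%VS).
Hypothesis GS : forall d, G d.+1 = (G 1%N * G d)%VS.
Hypothesis prD : forall d, {morph pr d : a b / a + b}.
Hypothesis pr_id : forall d, {in G d, forall a, pr d a = a}.
Hypothesis pr_0 : forall d e, d != e -> {in G e, forall a, pr d a = 0}.
Hypothesis pr_sum : forall a, a = \sum_(d < k.+2) pr d a.
Hypothesis pr_mem : forall d a, pr d a \in G d.
Hypothesis dimG : forall d, \dim (G d) = T131 k d.
Hypothesis socG : forall a, {in G 1%N, forall y, y * a = 0} -> a \in G k.+1.

(** The projections pr witness at once that the G d are independent and that they
span; independence makes the kernel of the evaluation at x homogeneous. *)
Lemma Gor_grading : exists pi : {lrmorphism {mpoly K[3]} -> A},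
  Gor pi (T131 k) /\ forall d, Adeg pi d = G d.
Proof.
have [pi piX] := mpoly_eval x mC; exists pi.
have Adeg1 : Adeg pi 1 = G 1%N.
  apply/eqP; rewrite eqEsubv; apply/andP; split; last first.
    rewrite G1; apply/span_subvP => _ /imageP[i _ ->]; rewrite -piX.
    by apply: Adeg_pi; rewrite dhomogX /= mdeg1.
  apply/subvP => _ /AdegP[p p_homog <-].
  rewrite [p]mpolyE linear_sum big_seq; apply: memv_suml => m /(dhomog_mf p_homog) /= m_deg.
  rewrite linearZ memvZ //=; have /mdeg1P[i /eqP->] : mdeg m == 1%N by apply/eqP.
  by rewrite piX G1 memv_span //; apply: image_f.
have AdegG d : Adeg pi d = G d.
  by elim: d => [|d IH]; [rewrite Adeg0 G0|rewrite AdegS IH Adeg1 -GS].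
split=> //; split; last by move=> d; rewrite AdegG.
- split=> [a|p p0 d].
    have prP d : exists p, pi p == pr d a.
      by have := pr_mem d a; rewrite -AdegG => /AdegP[p _ <-]; exists p.
    exists (\sum_(d < k.+2) xchoose (prP d)); rewrite linear_sum [RHS]pr_sum.
    by apply: eq_bigr => d _; apply/eqP/(xchooseP (prP d)).
  have homogG e : pi (pihomog mdeg e p) \in G e by rewrite -AdegG Adeg_pi ?pihomogP.
  have pr0 : pr d 0 = 0.
    by apply: (addrI (pr d 0)); rewrite -prD !addr0.
  have pr_big n (F : nat -> A) : pr d (\sum_(e < n) F e) = \sum_(e < n) pr d (F e).
    by apply: (big_morph (pr d) (prD d) pr0).
  (* The bound n exceeds d, so that the term of degree d is in the sum. *)
  pose n := maxn (mmeasure mdeg p) d.+1.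
  have := @pihomog_partitionE 3 K mdeg n p (leq_maxl _ _) => Dp.
  have := congr1 (pr d) p0; rewrite pr0 {1}Dp linear_sum /=.
  rewrite (pr_big n (fun e => pi (pihomog mdeg e p))).
  have d_lt : (d < n)%N by rewrite leq_max ltnSn orbT.
  rewrite (bigD1 (Ordinal d_lt)) //= pr_id // big1 ?addr0 // => e e_neq.
  by apply: pr_0 (homogG e); rewrite eq_sym; apply: contra e_neq => /eqP ed;
    apply/eqP/val_inj.
- have GD a b : (G a * G b)%VS = G (a + b)%N.
    by elim: a => [|a IH]; [rewrite G0 prod1v|rewrite GS -prodvA IH addSn -GS].
  exists (G k.+1); split; last by rewrite dimG /T131 /= nth_rcons size_nseq ltnn eqxx.
  move=> a; split=> [aG d b d_gt0|soc]; last first.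
    by apply: socG => y yG; apply: (soc 1%N) => //; rewrite AdegG.
  rewrite AdegG => bG; apply/eqP; rewrite -memv0.
  have <- : G (d + k.+1)%N = 0%VS.
    apply/eqP; rewrite -dimv_eq0 dimG /T131 nth_default //= size_rcons size_nseq; lia.
  by rewrite -GD memv_mul.
Qed.

End Grading.

(** * The three-dimensional algebras C = K[X,e]/(X^2 - sX - te, Xe, e^2) *)

(** The triple (y, x, z) stands for y + xX + ze.  For (s, t) = (1, 0) the element X
is idempotent and the algebra is K x K[e]/(e^2); for (s, t) = (0, 1) one has e = X^2
and the algebra is K[X]/(X^3). *)
Definition cubic (K : fieldType) (s t : K) : Type := (K^o * K^o * K^o)%type.

Section Cubic.

Variables (K : fieldType) (s t : K).
Local Notation C := (cubic s t).

HB.instance Definition _ := Vector.copy C (K^o * K^o * K^o)%type.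

Definition cub (y x z : K) : C := (y, x, z).
Definition cunit (a : C) : K := a.1.1.
Definition cX (a : C) : K := a.1.2.
Definition ceps (a : C) : K := a.2.

Definition cubic_mul (a b : C) : C :=
  cub (cunit a * cunit b) (cunit a * cX b + cX a * cunit b + s * cX a * cX b)
    (cunit a * ceps b + ceps a * cunit b + t * cX a * cX b).

Lemma cubicP (a b : C) : cunit a = cunit b -> cX a = cX b -> ceps a = ceps b -> a = b.
Proof. by case: a b => [[? ?] ?] [[? ?] ?]; rewrite /cunit /cX /ceps /= => -> -> ->. Qed.

Fact cubic_mulA : associative cubic_mul.
Proof. by move=> a b c; apply: cubicP; rewrite /cubic_mul /cub /cunit /cX /ceps /=;
  ring. Qed.
Fact cubic_mulC : commutative cubic_mul.
Proof. by move=> a b; apply: cubicP; rewrite /cubic_mul /cub /cunit /cX /ceps /=; ring. Qed.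
Fact cubic_mul1 : left_id (cub 1 0 0) cubic_mul.
Proof. by move=> a; apply: cubicP; rewrite /cubic_mul /cub /cunit /cX /ceps /=; ring. Qed.
Fact cubic_mulDl : left_distributive cubic_mul +%R.
Proof. by move=> a b c; apply: cubicP; rewrite /cubic_mul /cub /cunit /cX /ceps /=;
  ring. Qed.
Fact cubic_1_neq0 : cub 1 0 0 != 0.
Proof. by apply/eqP => /(congr1 cunit) /eqP; rewrite /cunit /= oner_eq0. Qed.

HB.instance Definition _ := GRing.Zmodule_isComNzRing.Build C
  cubic_mulA cubic_mulC cubic_mul1 cubic_mulDl cubic_1_neq0.

Lemma cunitM (a b : C) : cunit (a * b) = cunit a * cunit b. Proof. by []. Qed.
Lemma cXM (a b : C) : cX (a * b) = cunit a * cX b + cX a * cunit b + s * cX a * cX b.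
Proof. by []. Qed.
Lemma cepsM (a b : C) :
  ceps (a * b) = cunit a * ceps b + ceps a * cunit b + t * cX a * cX b.
Proof. by []. Qed.
Lemma cunitD (a b : C) : cunit (a + b) = cunit a + cunit b. Proof. by []. Qed.
Lemma cXD (a b : C) : cX (a + b) = cX a + cX b. Proof. by []. Qed.
Lemma cepsD (a b : C) : ceps (a + b) = ceps a + ceps b. Proof. by []. Qed.
Lemma cunitZ c (a : C) : cunit (c *: a) = c * cunit a. Proof. by []. Qed.
Lemma cXZ c (a : C) : cX (c *: a) = c * cX a. Proof. by []. Qed.
Lemma cepsZ c (a : C) : ceps (c *: a) = c * ceps a. Proof. by []. Qed.
Lemma cubK y x z : (cunit (cub y x z) = y) * (cX (cub y x z) = x) * (ceps (cub y x z) = z).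
Proof. by []. Qed.
Lemma cunit1 : cunit (1 : C) = 1. Proof. by []. Qed.
Lemma cX1 : cX (1 : C) = 0. Proof. by []. Qed.
Lemma ceps1 : ceps (1 : C) = 0. Proof. by []. Qed.

Definition cubE := (cunitM, cXM, cepsM, cunitD, cXD, cepsD, cunitZ, cXZ, cepsZ, cubK,
  cunit1, cX1, ceps1).

Lemma dim_cubic : \dim {: C} = 3%N.
Proof. by rewrite dimvf. Qed.

End Cubic.

(** * The algebra K + Ct + ... + C t^k + K t^(k+1) *)

(** The components are the coefficient of 1, those of t, ..., t^k, and the
value of phi on the coefficient of t^(k+1). *)
Definition pinched (K : fieldType) (s t mu : K) (k : nat) : Type :=
  (K^o * {ffun 'I_k -> cubic s t} * K^o)%type.

Section Pinched.

Variables (K : fieldType) (s t mu : K) (k : nat).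
Local Notation C := (cubic s t).
Local Notation B := (pinched s t mu k).

HB.instance Definition _ := Vector.copy B (K^o * {ffun 'I_k -> cubic s t} * K^o)%type.

(** This is phi.  The Gram determinant of the bilinear form phi(xy) in the basis 1, X, e is
-(s^2 + t); the parameter mu = phi(1) is free. *)
Definition topform (a : C) : K := mu * cunit a + s * cX a + ceps a.

#[local] Arguments topform : simpl never.

Lemma topform_linear : scalar topform.
Proof. by move=> c a b; rewrite /topform !cubE; ring. Qed.
HB.instance Definition _ := GRing.isLinear.Build K C K *%R topform topform_linear.

Lemma topformD a b : topform (a + b) = topform a + topform b.
Proof. exact: linearD. Qed.

Lemma topformZ c a : topform (c *: a) = c * topform a.
Proof. exact: linearZ. Qed.

(** The algebra is the quotient of the subring K + tC[t] of C[t] by the ideal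
(ker phi)t^(k+1) + t^(k+2)C[t].  This is the quotient map; [to_poly] is a section
of it. *)
Definition of_poly (p : {poly C}) : B :=
  (cunit p`_0, [ffun i : 'I_k => p`_i.+1], topform p`_k.+1).

(** In the top degree the representative of phi-value a is ae, as phi(e) = 1. *)
Definition component (a : B) (d : nat) : C :=
  if d == 0%N then cub s t a.1.1 0 0
  else if d == k.+1 then cub s t 0 0 a.2 else oapp a.1.2 0 (insub d.-1).

Definition to_poly (a : B) : {poly C} := \poly_(d < k.+2) component a d.

Definition scal (c : K) : C := cub s t c 0 0.

(** Membership in the subring K + tC[t], on which [of_poly] is
multiplicative. *)
Definition scalar_start (p : {poly C}) : Prop := p`_0 = scal (cunit p`_0).

Lemma pinchedP (a b : B) : a.1.1 = b.1.1 -> (forall i, a.1.2 i = b.1.2 i) -> a.2 = b.2 ->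
  a = b.
Proof. by case: a b => [[? ?] ?] [[? ?] ?] /= -> /ffunP -> ->. Qed.

Lemma cunit_scal c : cunit (scal c) = c. Proof. by []. Qed.
Lemma cX_scal c : cX (scal c) = 0. Proof. by []. Qed.
Lemma ceps_scal c : ceps (scal c) = 0. Proof. by []. Qed.
Definition scalE := (cunit_scal, cX_scal, ceps_scal).

Lemma scalZ c (a : C) : scal c * a = c *: a.
Proof. by apply: cubicP; rewrite !(cubE, scalE); ring. Qed.

Lemma component_mid a (i : 'I_k) : component a i.+1 = a.1.2 i.
Proof. by rewrite /component /= eqSS ltn_eqF ?ltn_ord // (valK i). Qed.

Lemma component_above a d : (k.+1 < d)%N -> component a d = 0.
Proof.
move=> d_gt; rewrite /component; case: d d_gt => // d; rewrite ltnS eqSS => d_gt.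
have -> : (d == k) = false by lia.
by rewrite /= insubF //=; lia.
Qed.

Lemma coef_to_poly a d : (to_poly a)`_d = component a d.
Proof. by rewrite coef_poly; case: ltnP => // d_gt; rewrite component_above. Qed.

Lemma to_polyK a : of_poly (to_poly a) = a.
Proof.
apply: pinchedP => [|i|] /=; rewrite ?ffunE ?coef_to_poly //.
- by rewrite component_mid.
- by rewrite /component eqxx /topform /cunit /cX /ceps /= !mulr0 !add0r.
Qed.

Lemma component_of_poly p d : scalar_start p -> (d < k.+1)%N ->
  component (of_poly p) d = p`_d.
Proof.
move=> p_adm; case: d => [_|d]; first by rewrite p_adm /component.
by rewrite ltnS => d_lt; rewrite (component_mid _ (Ordinal d_lt)) ffunE.
Qed.

Lemma topform_component_of_poly p : topform (component (of_poly p) k.+1) = topform p`_k.+1.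
Proof. by rewrite /component eqxx {1}/topform /cunit /cX /ceps /= !mulr0 !add0r. Qed.

Lemma scalar_start_to_poly a : scalar_start (to_poly a).
Proof. by rewrite /scalar_start coef_to_poly. Qed.

Lemma scalar_start_mul p q : scalar_start p -> scalar_start q -> scalar_start (p * q).
Proof.
rewrite /scalar_start coefM big_ord1 subnn => -> ->; rewrite scalZ.
by apply: cubicP; rewrite !(cubE, scalE); ring.
Qed.

Lemma topformM_scal (a : C) c : topform (a * scal c) = topform a * c.
Proof. by rewrite mulrC scalZ topformZ mulrC. Qed.

(** The two products differ by an element of the kernel, since replacing p by
its representative only changes the coefficients from t^(k+1) on, and there by an
element of ker phi which gets multiplied by the scalar constant term of q. *)
Lemma of_to_of p q : scalar_start p -> scalar_start q ->
  of_poly (to_poly (of_poly p) * q) = of_poly (p * q).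
Proof.
move=> p_adm q_adm.
have eq_low d : (d < k.+1)%N -> (to_poly (of_poly p) * q)`_d = (p * q)`_d.
  move=> d_lt; rewrite !coefM; apply: eq_bigr => i _.
  by rewrite coef_to_poly component_of_poly //; case: i => i /=; lia.
apply: pinchedP => [|i|] /=; first by rewrite eq_low.
  by rewrite !ffunE eq_low // ltnS.
rewrite !coefM big_ord_recr [in RHS]big_ord_recr /= !subnn !topformD; congr (_ + _).
  congr (topform _); apply: eq_bigr => i _; rewrite coef_to_poly component_of_poly //.
by rewrite q_adm !topformM_scal coef_to_poly topform_component_of_poly.
Qed.

Lemma of_polyD p q : of_poly (p + q) = of_poly p + of_poly q.
Proof. by apply: pinchedP => [|i|] /=; rewrite ?ffunE ?coefD ?topformD. Qed.

Lemma to_polyD a b : to_poly (a + b) = to_poly a + to_poly b.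
Proof.
apply/polyP => d; rewrite coefD !coef_to_poly /component; case: eqP => _.
  by apply: cubicP; rewrite /= /cunit /cX /ceps /= ?addr0.
case: eqP => _; first by apply: cubicP; rewrite /= /cunit /cX /ceps /= ?addr0.
by case: insub => [i|] /=; rewrite ?ffunE ?addr0.
Qed.

Lemma of_polyZ c p : of_poly ((scal c)%:P * p) = c *: of_poly p.
Proof.
apply: pinchedP => [|i|] /=; rewrite ?ffunE ?coefCM scalZ ?topformZ //.
Qed.

Lemma to_polyZ c a : to_poly (c *: a) = (scal c)%:P * to_poly a.
Proof.
apply/polyP => d; rewrite coefCM !coef_to_poly scalZ /component; case: eqP => _.
  by apply: cubicP; rewrite /= /cunit /cX /ceps /= /GRing.scale /= ?mulr0.
case: eqP => _; first by apply: cubicP;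
  rewrite /= /cunit /cX /ceps /= /GRing.scale /= ?mulr0.
by case: insub => [i|] /=; rewrite ?ffunE ?scaler0.
Qed.

Lemma scalar_start1 : scalar_start 1.
Proof. by rewrite /scalar_start coef1. Qed.

Definition pinched_mul (a b : B) : B := of_poly (to_poly a * to_poly b).
Definition pinched_one : B := of_poly 1.

Fact pinched_mulC : commutative pinched_mul.
Proof. by move=> a b; rewrite /pinched_mul mulrC. Qed.

Fact pinched_mulA : associative pinched_mul.
Proof.
move=> a b c; rewrite pinched_mulC /pinched_mul !of_to_of; first by congr of_poly;
  rewrite mulrC mulrA.
all: by do ?[apply: scalar_start_mul]; apply: scalar_start_to_poly.
Qed.

Fact pinched_mul1 : left_id pinched_one pinched_mul.
Proof.
move=> a; rewrite /pinched_mul /pinched_one of_to_of ?mul1r ?to_polyK //;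
  first exact: scalar_start1.
exact: scalar_start_to_poly.
Qed.

Fact pinched_mulDl : left_distributive pinched_mul +%R.
Proof. by move=> a b c; rewrite /pinched_mul to_polyD mulrDl of_polyD. Qed.

Fact pinched_1_neq0 : pinched_one != 0.
Proof. by apply/eqP => /(congr1 (fun a : B => a.1.1)) /eqP;
  rewrite /= coef1 /cunit /= oner_eq0. Qed.

HB.instance Definition _ := GRing.Zmodule_isComNzRing.Build B
  pinched_mulA pinched_mulC pinched_mul1 pinched_mulDl pinched_1_neq0.

Fact pinched_scaleAl (c : K) (a b : B) : c *: (a * b) = (c *: a) * b.
Proof.
rewrite -[a * b]/(pinched_mul a b) -[RHS]/(pinched_mul (c *: a) b) /pinched_mul.
by rewrite -of_polyZ to_polyZ mulrA.
Qed.
HB.instance Definition _ := GRing.Lmodule_isLalgebra.Build K B pinched_scaleAl.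
HB.instance Definition _ := GRing.Lalgebra_isComAlgebra.Build K B.
HB.instance Definition _ := Algebra_isFalgebra.Build K B.

End Pinched.

(** * The grading of that algebra *)

Section PinchedGrading.

Variables (K : fieldType) (s t mu : K) (k : nat).
Local Notation C := (cubic s t).
Local Notation B := (pinched s t mu k).
Local Notation ofp := (@of_poly K s t mu k).
Local Notation phi := (@topform K s t mu).

Fact mono_key : unit. Proof. exact: tt. Qed.
(** The class of ct^d; in degree 0 only the scalar part of c survives, and in
degree k+1 only phi(c). *)
Definition mono : nat -> C -> B := locked_with mono_key (fun d c => ofp (c%:P * 'X^d)).

Lemma mono_of_poly d c : mono d c = ofp (c%:P * 'X^d).
Proof. by rewrite [mono]unlock. Qed.

Lemma mono_unit d c : (mono d c).1.1 = if d == 0%N then cunit c else 0.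
Proof. by rewrite mono_of_poly /= coefCM coefXn eq_sym; case: eqP => _;
  rewrite ?mulr1 ?mulr0. Qed.

Lemma mono_mid d c i : (mono d c).1.2 i = if d == i.+1 then c else 0.
Proof. by rewrite mono_of_poly /= ffunE coefCM coefXn eq_sym; case: eqP => _;
  rewrite ?mulr1 ?mulr0. Qed.

Lemma mono_top d c : (mono d c).2 = if d == k.+1 then phi c else 0.
Proof.
rewrite mono_of_poly /= coefCM coefXn eq_sym; case: eqP => _; rewrite ?mulr1 ?mulr0 //.
by rewrite -[0]/(0 : C) -(scale0r (0 : C)) topformZ mul0r.
Qed.

Definition monoE := (mono_unit, mono_mid, mono_top).

Lemma mono_linear d : linear (mono d).
Proof.
move=> c a b; rewrite !mono_of_poly -of_polyZ -of_polyD mulrA -polyCM scalZ -mulrDl.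
by rewrite -polyCD.
Qed.
HB.instance Definition _ d := GRing.isLinear.Build K C B *:%R (mono d) (mono_linear d).

Lemma monoD d a b : mono d (a + b) = mono d a + mono d b.
Proof. exact: linearD. Qed.

Lemma monoZ d c a : mono d (c *: a) = c *: mono d a.
Proof. exact: linearZ. Qed.

Lemma mono0 d : mono d 0 = 0.
Proof. exact: linear0. Qed.

Lemma ofM p q : scalar_start p -> scalar_start q -> ofp p * ofp q = ofp (p * q).
Proof.
move=> p_adm q_adm; rewrite -[LHS]/(ofp (to_poly (ofp p) * to_poly (ofp q))).
rewrite of_to_of //; last exact: scalar_start_to_poly.
by rewrite mulrC of_to_of // mulrC.
Qed.

Lemma scalar_start_mono d (c : C) : (0 < d)%N || (c == scal s t (cunit c)) ->
  scalar_start (c%:P * 'X^d).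
Proof.
rewrite /scalar_start coefCM coefXn; case: d => [|d] /=; first by rewrite mulr1 => /eqP.
by rewrite mulr0.
Qed.

Lemma monoM d e (a b : C) : (0 < d)%N || (a == scal s t (cunit a)) ->
  (0 < e)%N || (b == scal s t (cunit b)) -> mono d a * mono e b = mono (d + e) (a * b).
Proof.
move=> d_adm e_adm; rewrite !mono_of_poly ofM; try exact: scalar_start_mono.
by rewrite mulrACA -polyCM -exprD.
Qed.

Lemma mono01 : mono 0 1 = 1.
Proof. by rewrite !mono_of_poly expr0 mulr1. Qed.

Lemma mono_exp (c : C) a : mono 1 c ^+ a = mono a (c ^+ a).
Proof.
elim: a => [|a IH]; first by rewrite !expr0 mono01.
rewrite !exprS IH monoM //; case: a {IH} => // ; by rewrite expr0 eqxx.
Qed.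

Lemma mono_above d c : (k.+1 < d)%N -> mono d c = 0.
Proof.
move=> d_gt; apply: pinchedP => [|i|]; rewrite monoE; last 1 first.
- by case: eqP => //; lia.
- by case: eqP => //; lia.
- by case: eqP => [Dd|]; rewrite ?ffunE //; have := ltn_ord i; lia.
Qed.

Definition pinched_deg (d : nat) : {vspace B} := limg (linfun (mono d)).

Lemma pinched_degP d a : reflect (exists c, a = mono d c) (a \in pinched_deg d).
Proof.
apply: (iffP memv_imgP) => [[c _ ->]|[c ->]]; exists c; rewrite ?memvf ?lfunE //.
Qed.

Lemma mem_mono d c : mono d c \in pinched_deg d.
Proof. by apply/pinched_degP; exists c. Qed.

Definition pinched_proj (d : nat) (a : B) : B := mono d (component a d).

Lemma pinched_projD d : {morph pinched_proj d : a b / a + b}.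
Proof.
by move=> a b; rewrite /pinched_proj -!coef_to_poly to_polyD coefD monoD.
Qed.

Lemma pinched_proj_id d : {in pinched_deg d, forall a, pinched_proj d a = a}.
Proof.
move=> _ /pinched_degP[c ->]; rewrite /pinched_proj /component.
have [->|d_neq0] := eqVneq d 0%N.
  apply: pinchedP => [|i|]; first by rewrite !mono_unit.
    by rewrite !mono_mid.
  by rewrite !mono_top.
have [->|d_neqk] := eqVneq d k.+1.
  apply: pinchedP => [|i|]; first by rewrite !mono_unit.
    by rewrite !mono_mid eqSS gtn_eqF ?ltn_ord.
  by rewrite !mono_top eqxx /topform !cubE !mulr0 !add0r.
case: insubP => [i _ Di|d_gt] /=.
  by rewrite mono_mid Di prednK ?lt0n // eqxx.
by rewrite mono0 mono_above //; lia.
Qed.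

Lemma pinched_proj_0 d e : d != e -> {in pinched_deg e, forall a, pinched_proj d a = 0}.
Proof.
move=> /eqP de _ /pinched_degP[c ->];
  rewrite /pinched_proj (_ : component _ _ = 0) ?mono0 //.
rewrite /component; case: eqP => [d0|d0]; first by rewrite mono_unit; case: eqP => // e0;
  lia.
case: eqP => [dk|_]; first by rewrite mono_top; case: eqP => // e0; lia.
case: insubP => //= i _ Di; rewrite mono_mid; case: eqP => // ei; lia.
Qed.

Lemma pinched_proj_mem d a : pinched_proj d a \in pinched_deg d.
Proof. exact: mem_mono. Qed.

Lemma pinched_proj_sum a : a = \sum_(d < k.+2) pinched_proj d a.
Proof.
rewrite -[LHS]to_polyK /to_poly poly_def.
have of_sum : {morph ofp : p q / p + q} by exact: of_polyD.
have of0 : ofp 0 = 0.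
  by have := linear0 (mono 0); rewrite /= mono_of_poly polyC0 mul0r.
rewrite (big_morph ofp of_sum of0); apply: eq_bigr => i _.
by rewrite -mul_polyC /pinched_proj mono_of_poly.
Qed.

Lemma pinched_deg0 : pinched_deg 0 = 1%VS.
Proof.
apply/vspaceP => a; apply/pinched_degP/vlineP => [[c ->]|[c ->]].
  exists (cunit c); rewrite -mono01 -monoZ.
  by apply: pinchedP => [|i|]; rewrite !monoE //= cubE mulr1.
by exists (c *: (1 : C)); rewrite monoZ mono01.
Qed.

Lemma pinched_degS d : pinched_deg d.+1 = (pinched_deg 1 * pinched_deg d)%VS.
Proof.
case: d => [|d]; first by rewrite pinched_deg0 prodv1.
apply/eqP; rewrite eqEsubv; apply/andP; split.
  apply/subvP => _ /pinched_degP[c ->]; rewrite -[c]mul1r -[d.+2]add1n -monoM //.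
  by rewrite memv_mul ?mem_mono.
by apply/prodvP => _ _ /pinched_degP[a ->] /pinched_degP[b ->]; rewrite monoM // mem_mono.
Qed.

Definition pinched_gens (i : 'I_3) : B :=
  mono 1 (nth 0 [:: cub s t 1 0 0; cub s t 0 1 0; cub s t 0 0 1] i).

Lemma pinched_deg1 : pinched_deg 1 = <<[seq pinched_gens i | i : 'I_3]>>%VS.
Proof.
apply/eqP; rewrite eqEsubv; apply/andP; split; last first.
  by apply/span_subvP => _ /imageP[i _ ->]; apply: mem_mono.
apply/subvP => _ /pinched_degP[c ->].
have -> : c = cunit c *: cub s t 1 0 0 + cX c *: cub s t 0 1 0 + ceps c *: cub s t 0 0 1.
  by apply: cubicP; rewrite !cubE; ring.
have gen_in (i : 'I_3) : pinched_gens i \in <<[seq pinched_gens i | i : 'I_3]>>%VS by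
  apply/memv_span/image_f.
rewrite !monoD !monoZ; do ![apply: memvD | apply: memvZ].
- exact: (gen_in ord0).
- exact: (gen_in (@Ordinal 3 1 isT)).
- exact: (gen_in (@Ordinal 3 2 isT)).
Qed.

Hypothesis nondeg : s * s + t != 0.

Lemma topform_nondeg b : (forall c, phi (c * b) = 0) -> b = 0.
Proof.
move=> b0.
have unit0 : cunit b = 0 by have := b0 (cub s t 0 0 1); rewrite /topform !cubE => <-; ring.
have X0 : cX b = 0.
  have : (s * s + t) * cX b = 0 by have := b0 (cub s t 0 1 0);
    rewrite /topform !cubE unit0 => <-; ring.
  by move/eqP; rewrite mulf_eq0 (negbTE nondeg) => /eqP.
apply: cubicP => //.
by have := b0 (cub s t 1 0 0); rewrite /topform !cubE unit0 X0; apply: etrans; ring.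
Qed.

(** An element killed by Ct has no component in degree below k, taking t
itself as multiplier, and none in degree k by nondegeneracy of phi. *)
Lemma pinched_socle (a : B) : {in pinched_deg 1, forall y, y * a = 0} ->
  a \in pinched_deg k.+1.
Proof.
move=> soc.
have mono_a c : mono 1 c * a = ofp ((c%:P * to_poly a) * 'X).
  rewrite -[a in LHS]to_polyK mono_of_poly ofM; first by rewrite expr1 mulrAC.
    exact: scalar_start_mono.
  exact: scalar_start_to_poly.
have comp0 d : (d < k)%N -> component a d = 0.
  move=> d_lt; have := congr1 (fun b : B => b.1.2 (Ordinal d_lt)) (soc _ (mem_mono 1 1)).
  by rewrite mono_a /= !ffunE coefMX /= coefCM mul1r coef_to_poly.
have compk : component a k = 0.
  apply: topform_nondeg => c; have := congr1 (fun b : B => b.2) (soc _ (mem_mono 1 c)).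
  by rewrite mono_a /= coefMX /= coefCM coef_to_poly.
rewrite [a]pinched_proj_sum big_ord_recr /= big1 ?add0r ?pinched_proj_mem // => i _.
rewrite /pinched_proj (_ : component a _ = 0) ?mono0 //=.
have [/comp0 //|i_ge] := ltnP i k.
by have -> : i = k :> nat by case: i i_ge => i /=; lia.
Qed.

Lemma dim_pinched_deg d : \dim (pinched_deg d) = T131 k d.
Proof.
case: d => [|d]; first by rewrite pinched_deg0 dimv1.
rewrite /T131 /= nth_rcons size_nseq nth_nseq; case: ltnP => d_lt.
  rewrite /pinched_deg limg_dim_eq ?dim_cubic //; apply/eqP; rewrite -subv0;
    apply/subvP => c.
  rewrite memv_cap memv_ker lfunE memv0 /= => /andP[_ /eqP/(congr1 (fun b : B =>
    b.1.2 (Ordinal d_lt)))].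
  by rewrite mono_mid eqxx ffunE => ->.
case: eqP => [->|d_neq]; last first.
  apply/eqP; rewrite dimv_eq0 -subv0; apply/subvP => _ /pinched_degP[c ->].
  by rewrite mono_above ?mem0v //; lia.
pose b := mono k.+1 (cub s t 0 0 1).
have bE : b.2 = 1 by rewrite mono_top eqxx /topform !cubE !mulr0 !add0r.
have -> : pinched_deg k.+1 = <[b]>%VS.
  apply/vspaceP => a; apply/pinched_degP/vlineP => [[c ->]|[c ->]].
    exists (phi c); apply: pinchedP => [|i|]; rewrite /= ?bE ?mulr1 ?mono_top ?eqxx //.
      by rewrite /b !mono_unit /= scaler0.
    rewrite ffunE /b !mono_mid /= eqSS gtn_eqF ?ltn_ord ?scaler0 //.
    by rewrite /GRing.scale /= mulr1.
  by exists (c *: cub s t 0 0 1); rewrite monoZ.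
rewrite dim_vline; apply/eqP; rewrite eqb1; apply/eqP => b0.
by have := bE; rewrite b0 => /eqP; rewrite eq_sym oner_eq0.
Qed.

Lemma pinched_Gor : exists pi : {lrmorphism {mpoly K[3]} -> B},
  Gor pi (T131 k) /\ forall d, Adeg pi d = pinched_deg d.
Proof.
apply: (@Gor_grading K B k pinched_gens pinched_deg pinched_proj (@mulrC B) pinched_deg0
  pinched_deg1 pinched_degS pinched_projD pinched_proj_id pinched_proj_0 pinched_proj_sum
    pinched_proj_mem dim_pinched_deg pinched_socle).
Qed.

End PinchedGrading.

(** * Realizing the types #1 to #8 *)

Lemma dim_Gor (K : fieldType) (A : falgType K) (pi : {lrmorphism {mpoly K[3]} -> A}) k :
  Gor pi (T131 k) -> \dim {:A} = (3 * k + 2)%N.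
Proof.
move=> gor; have gg := Gor_graded_gorenstein gor.
rewrite -(gg_full gg) (directvP (gg_direct gg)) /= big_ord_recl big_ord_recr /=.
have [_ _ dimG] := gor; rewrite !dimG (eq_bigr (fun=> 3%N)) => [|i _].
  rewrite sum_nat_const card_ord /T131 /= nth_rcons size_nseq ltnn eqxx; lia.
by rewrite dimG /T131 /= nth_rcons size_nseq ltn_ord nth_nseq ltn_ord.
Qed.

(** The lengths add up to dim A, so strings that span A form a basis. *)
Lemma is_JDT_spanning (K : fieldType) (A : falgType K)
    (pi : {lrmorphism {mpoly K[3]} -> A}) k l (s : seq (A * (nat * nat))) :
    Gor pi (T131 k) ->
    (forall v p nu, (v, (p, nu)) \in s ->
       [/\ (0 < p)%N, v \in Adeg pi nu & l ^+ p * v = 0]) ->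
    (forall d, (d < k.+2)%N -> (Adeg pi d <=
       <<(flatten [seq [seq l ^+ a * w.1 | a <- iota 0 w.2.1] | w <- s])%R>>)%VS) ->
    sumn [seq w.2.1 | w <- s] = (3 * k + 2)%N ->
  is_JDT (Adeg pi) l (seq_mset [seq w.2 | w <- s]).
Proof.
move=> gor s_string s_span s_size; exists s; split=> //.
rewrite basisEdim (dim_Gor gor) size_flatten /shape -map_comp.
rewrite (eq_map (_ : _ =1 fun w => w.2.1)) => [|w /=]; last by rewrite size_map size_iota.
rewrite s_size leqnn andbT -(gg_full (Gor_graded_gorenstein gor)).
by apply/subv_sumP => d _; apply: s_span.
Qed.

Section PinchedOccurs.

Variables (K : fieldType) (s t mu : K) (k : nat).
Hypotheses (nondeg : s * s + t != 0) (k_gt0 : (0 < k)%N).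
Local Notation C := (cubic s t).
Local Notation phi := (@topform K s t mu).
Local Notation mono := (@mono K s t mu k).

Variables (c : C) (strs : seq (C * (nat * nat))).

(** A string that starts in degree 0 has to start at 1, since the class of ct^0
forgets the nonscalar part of c.  The three ways to end a string of length p at
xt^nu are to run beyond the top degree, to meet c^p x = 0 in C, or to reach the
top degree with value 0 under phi. *)
Definition good_string (w : C * (nat * nat)) : bool :=
  [&& (0 < w.2.1)%N, (0 < w.2.2)%N || (w.1 == 1)
    & [|| (k.+1 < w.2.1 + w.2.2)%N, c ^+ w.2.1 * w.1 == 0
        | (w.2.1 + w.2.2 == k.+1)%N && (phi (c ^+ w.2.1 * w.1) == 0)]].

Lemma good_long x p nu : (0 < nu)%N || (x == 1) -> (k.+1 < p + nu)%N -> (0 < p)%N ->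
  good_string (x, (p, nu)).
Proof. by rewrite /good_string /= => -> -> ->. Qed.

Lemma good_zero x p nu : (0 < nu)%N || (x == 1) -> c ^+ p * x = 0 -> (0 < p)%N ->
  good_string (x, (p, nu)).
Proof. by rewrite /good_string /= => -> /eqP -> ->; rewrite orbT. Qed.

Lemma good_top x p nu : (0 < nu)%N || (x == 1) -> (p + nu = k.+1)%N ->
  phi (c ^+ p * x) = 0 ->
  (0 < p)%N -> good_string (x, (p, nu)).
Proof. by rewrite /good_string /= => -> /eqP -> /eqP -> ->; rewrite !orbT. Qed.

(** Some string has the class of et^d as its element of degree d. *)
Definition reaches (d : nat) (e : C) : Prop :=
  exists x p nu, [/\ (x, (p, nu)) \in strs, (nu <= d < nu + p)%N & c ^+ (d - nu) * x = e].

Lemma reaches_intro x p nu d e : (x, (p, nu)) \in strs -> (nu <= d < nu + p)%N ->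
  c ^+ (d - nu) * x = e -> reaches d e.
Proof. by exists x, p, nu. Qed.

Hypothesis c_neq0 : c != 0.
Hypothesis strs_good : all good_string strs.
Hypothesis strs_size : sumn [seq w.2.1 | w <- strs] = (3 * k + 2)%N.
Hypothesis reaches0 : reaches 0 1.
Hypothesis reaches_top : exists2 e, reaches k.+1 e & phi e != 0.
Hypothesis reaches_mid : forall d, (0 < d <= k)%N -> exists e1 e2 e3,
  [/\ reaches d e1, reaches d e2, reaches d e3
    & forall y, exists a1 a2 a3, y = a1 *: e1 + a2 *: e2 + a3 *: e3].

Lemma one_is_scalar d (x : C) : (0 < d)%N || (x == 1) ->
  (0 < d)%N || (x == scal s t (cunit x)).
Proof. by case: (0 < d)%N => //= /eqP->. Qed.

Lemma pow_adm a : (0 < a)%N || (c ^+ a == 1).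
Proof. by case: a => // ; rewrite expr0 eqxx. Qed.

(** The strings at degree d have to span C in a middle degree, and one of
them has to be nonzero in the degrees 0 and k+1, which are lines. *)
Lemma pinched_occurs : occurs K k (seq_mset [seq w.2 | w <- strs]).
Proof.
have [pi [gor AdegE]] := pinched_Gor mu k nondeg.
pose l := mono 1 c; pose mk (w : C * (nat * nat)) := (mono w.2.2 w.1, w.2).
have lE a d x : (0 < d)%N || (x == 1) -> l ^+ a * mono d x = mono (a + d) (c ^+ a * x).
  by move=> d_adm; rewrite mono_exp monoM //; apply: one_is_scalar => //; apply: pow_adm.
exists (pinched s t mu k), pi, l; split=> //.
- by rewrite AdegE mem_mono.
- apply: contra c_neq0 => /eqP l0; apply/eqP.
  have := congr1 (fun b : pinched s t mu k => b.1.2 (Ordinal k_gt0)) l0.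
  by rewrite mono_mid ffunE.
have -> : [seq w.2 | w <- strs] = [seq w.2 | w <- map mk strs] by rewrite -map_comp.
apply: (is_JDT_spanning gor); last by rewrite -map_comp; exact: strs_size.
- move=> v p nu /mapP[[x [q n]] w_in [-> -> ->]] /=.
  have /and3P[/= q_gt0 n_adm vanish] := allP strs_good _ w_in.
  split=> //; first by rewrite AdegE mem_mono.
  rewrite lE //; case/or3P: vanish => [/mono_above //|/eqP->|]; first exact: mono0.
  case/andP=> /eqP -> /eqP phi0; apply: pinchedP => [|i|].
  + by rewrite mono_unit.
  + by rewrite mono_mid eqSS gtn_eqF ?ltn_ord // ffunE.
  + by rewrite mono_top eqxx.
move=> d d_lt; rewrite AdegE; set S := <<_>>%VS.
have hit_in e : reaches d e -> mono d e \in S.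
  case=> x [p [nu [w_in /andP[nu_le d_lt'] <-]]]; apply/memv_span/flatten_mapP.
  exists (mk (x, (p, nu))); first exact: map_f.
  apply/mapP; exists (d - nu)%N; first by rewrite mem_iota /=; lia.
  have /and3P[_ n_adm _] := allP strs_good _ w_in.
  by rewrite /= lE // subnK.
apply/subvP => _ /pinched_degP[y ->].
have [d0|d_neq0] := eqVneq d 0%N.
  have := hit_in 1; rewrite d0 => /(_ reaches0) in_S.
  suff -> : mono 0 y = cunit y *: mono 0 1 by apply: memvZ.
  by rewrite -monoZ; apply: pinchedP => [|i|];
    rewrite ?mono_unit ?mono_mid ?mono_top //= !cubE mulr1.
have [dk|d_neqk] := eqVneq d k.+1.
  have [e hit_e phi_neq0] := reaches_top; have := hit_in e; rewrite dk => /(_ hit_e) in_S.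
  suff -> : mono k.+1 y = (phi y / phi e) *: mono k.+1 e by apply: memvZ.
  rewrite -monoZ; apply: pinchedP => [|i|].
  + by rewrite !mono_unit.
  + by rewrite !mono_mid eqSS gtn_eqF ?ltn_ord.
  + by rewrite !mono_top eqxx topformZ divfK.
have [|e1 [e2 [e3 [h1 h2 h3 /(_ y)[a1 [a2 [a3 ->]]]]]]] := reaches_mid (d := d); first lia.
by rewrite !monoD !monoZ !memvD ?memvZ ?hit_in.
Qed.

End PinchedOccurs.

Section Strings.

Variables (C : Type).

Definition up_strings (x : C) p a b : seq (C * (nat * nat)) := [seq (x, w) | w <- up p a b].

Lemma up_strings_snd x p a b : [seq w.2 | w <- up_strings x p a b] = up p a b.
Proof. by rewrite -map_comp map_id. Qed.

Lemma up_strings_sumn x p a b :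
  sumn [seq w.2.1 | w <- up_strings x p a b] = (p * (b.+1 - a))%N.
Proof.
rewrite /up_strings /up -!map_comp /index_iota; move: (b.+1 - a)%N => n.
by elim: n a => [|n IH] a /=; rewrite ?muln0 // IH mulnS.
Qed.

Lemma all_up_strings (P : pred (C * (nat * nat))) x p a b :
  (forall nu, (a <= nu <= b)%N -> P (x, (p, nu))) -> all P (up_strings x p a b).
Proof.
move=> H; rewrite /up_strings all_map; apply/allP => _ /mapP[nu + ->].
by rewrite mem_index_iota ltnS => /H.
Qed.

End Strings.

Lemma mem_up_strings (C : eqType) (x : C) p a b nu :
  ((x, (p, nu)) \in up_strings x p a b) = (a <= nu <= b)%N.
Proof.
rewrite mem_map; last by move=> ? ? [].
by rewrite mem_map ?mem_index_iota ?ltnS // => ? ? [].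
Qed.

Section Examples.

Variables (K : fieldType) (k : nat).
Hypothesis k_gt0 : (0 < k)%N.

Lemma idem_exp (R : pzSemiRingType) (e : R) n : e * e = e -> (0 < n)%N -> e ^+ n = e.
Proof. by move=> ee; case: n => // n _; elim: n => [|n IH]; rewrite ?expr1 // exprS IH. Qed.

Ltac cub_ring := apply: cubicP; rewrite !cubE; ring.

Ltac reach_up x p nu := apply: (@reaches_intro _ _ _ _ _ x p nu);
  [rewrite ?mem_cat ?mem_up_strings; lia | lia | ].

Lemma topform_cub (s t mu y x z : K) : topform mu (cub s t y x z) = mu * y + s * x + z.
Proof. by rewrite /topform !cubE. Qed.

Lemma cub_neq0 (s t y x z : K) : (y != 0) || (x != 0) || (z != 0) -> cub s t y x z != 0.
Proof.
apply: contraL => /eqP E.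
have := congr1 (@cunit K s t) E; have := congr1 (@cX K s t) E;
  have := congr1 (@ceps K s t) E.
by rewrite !cubE => -> -> ->; rewrite !eqxx.
Qed.

Lemma split_nondeg : 1 * 1 + 0 != 0 :> K. Proof. by rewrite mulr1 addr0 oner_neq0. Qed.
Lemma local_nondeg : 0 * 0 + 1 != 0 :> K. Proof. by rewrite mulr0 add0r oner_neq0. Qed.

Local Notation cs := (@cub K 1 0).

(** c = 1 and phi(1) = 1; the two other strings start in ker phi. *)
Lemma occurs1 : occurs K k (jdt1 k.+1).
Proof.
pose one : cubic (1 : K) 0 := 1; pose X1 := cs 0 1 (-1); pose X2 := cs 1 (-1) 0.
apply: (@pinched_occurs K 1 0 1 k split_nondeg k_gt0 one
  [:: (one, (k.+2, 0%N)); (X1, (k, 1%N)); (X2, (k, 1%N))]).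
- exact: oner_neq0.
- apply/and4P; split=> //.
  + by apply: good_long; rewrite ?eqxx ?addn0.
  + apply: good_top; rewrite ?addn1 // expr1n mul1r topform_cub; ring.
  + apply: good_top; rewrite ?addn1 // expr1n mul1r topform_cub; ring.
- rewrite /=; lia.
- by apply: (reaches_intro (mem_head _ _)); rewrite ?expr0 ?mul1r.
- exists one; last by rewrite topform_cub mulr1 mulr0 !addr0 oner_neq0.
  by apply: (reaches_intro (mem_head _ _)); rewrite ?expr1n ?mul1r //; lia.
- move=> d /andP[d_gt0 d_le]; exists one, X1, X2; split.
  + by apply: (reaches_intro (mem_head _ _)); rewrite ?expr1n ?mul1r //; lia.
  + by apply: (@reaches_intro _ _ _ _ _ X1 k 1);
      rewrite ?inE ?eqxx ?orbT ?expr1n ?mul1r //; lia.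
  + by apply: (@reaches_intro _ _ _ _ _ X2 k 1);
      rewrite ?inE ?eqxx ?orbT ?expr1n ?mul1r //; lia.
  move=> y; exists (cunit y + cX y + ceps y), (- ceps y), (- cX y - ceps y).
  by apply: cubicP; rewrite !cubE; ring.
Qed.

(** c = e with (s, t) = (1, 0); the strings of length 2 are t^d, et^(d+1). *)
Lemma occurs8 : occurs K k (jdt8 k.+1).
Proof.
pose one : cubic (1 : K) 0 := 1; pose X := cs 0 1 0; pose e := cs 0 0 1.
have eX : e * X = 0 by cub_ring.
have ee : e * e = 0 by cub_ring.
have -> : jdt8 k.+1 = seq_mset [seq w.2 | w <- up_strings one 2 0 (k.+1 - 1) ++
  up_strings X 1 1 (k.+1 - 1)].
  by rewrite map_cat !up_strings_snd.
apply: (@pinched_occurs K 1 0 0 k split_nondeg k_gt0 e).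
- by apply: cub_neq0; rewrite oner_neq0 !orbT.
- rewrite all_cat; apply/andP; split; apply: all_up_strings => nu nu_le.
    by apply: good_zero; rewrite ?eqxx ?orbT // mulr1 expr2.
  by apply: good_zero => //; lia.
- rewrite map_cat sumn_cat !up_strings_sumn; lia.
- by reach_up one 2%N 0%N; rewrite mul1r.
- exists e; last by rewrite topform_cub mulr0 mulr0 !add0r oner_neq0.
  by reach_up one 2%N k; rewrite subSnn mulr1.
- move=> d /andP[d_gt0 d_le]; exists one, e, X; split.
  + by reach_up one 2%N d; rewrite subnn mulr1.
  + by reach_up one 2%N d.-1; have -> : (d - d.-1 = 1)%N by [lia]; rewrite mulr1.
  + by reach_up X 1%N d; rewrite subnn mul1r.
  move=> y; exists (cunit y), (ceps y), (cX y).
  by apply: cubicP; rewrite !cubE; ring.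
Qed.

Hypothesis k_gt1 : (1 < k)%N.

(** c is the idempotent f = 1 - X, for which phi(f) = 1; the other string of
length k starts in the part of fC killed by phi, and X is killed by f. *)
Lemma occurs2 : occurs K k (jdt2 k.+1).
Proof.
pose one : cubic (1 : K) 0 := 1; pose X := cs 0 1 0; pose f := cs 1 (-1) 0;
  pose g := cs 1 (-1) (-1).
have fX : f * X = 0 by cub_ring.
have fn n : (0 < n)%N -> f ^+ n = f by apply: idem_exp; cub_ring.
have fg n : f ^+ n * g = g.
  elim: n => [|n IH]; first by rewrite mul1r.
  by rewrite exprS -mulrA IH; cub_ring.
have -> : jdt2 k.+1 = seq_mset [seq w.2 | w <- [:: (one, (k.+2, 0%N));
  (g, (k, 1%N))] ++ up_strings X 1 1 (k.+1 - 1)].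
  by rewrite map_cat !up_strings_snd.
apply: (@pinched_occurs K 1 0 2%:R k split_nondeg k_gt0 f).
- by apply: cub_neq0; rewrite oner_neq0.
- apply/and3P; split; last first.
  + by apply: all_up_strings => nu nu_le; apply: good_zero => //; lia.
  + by apply: good_top; rewrite ?addn1 // fg topform_cub; ring.
  + by apply: good_long; rewrite ?eqxx ?addn0.
- rewrite map_cat sumn_cat !up_strings_sumn /=; lia.
- by apply: (reaches_intro (mem_head _ _)); rewrite ?expr0 ?mul1r.
- exists f; last by rewrite topform_cub;
    have -> : 2%:R * 1 + 1 * -1 + 0 = 1 :> K by [ring]; exact: oner_neq0.
  by apply: (reaches_intro (mem_head _ _)); rewrite ?subn0 ?fn ?mulr1 //; lia.
- move=> d /andP[d_gt0 d_le]; exists f, g, X; split.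
  + by apply: (reaches_intro (mem_head _ _)); rewrite ?subn0 ?fn ?mulr1 //; lia.
  + by apply: (@reaches_intro _ _ _ _ _ g k 1); rewrite ?inE ?eqxx ?orbT ?fg //; lia.
  + by reach_up X 1%N d; rewrite subnn mul1r.
  move=> y; exists (cunit y + ceps y), (- ceps y), (cX y + cunit y).
  by cub_ring.
Qed.

(** c = X + e is idempotent from its square on, and (1 - X)t^d, et^(d+1) are the
strings of length 2. *)
Lemma occurs3 : occurs K k (jdt3 k.+1).
Proof.
pose one : cubic (1 : K) 0 := 1; pose X := cs 0 1 0; pose e := cs 0 0 1.
pose f := cs 1 (-1) 0; pose g := cs 1 (- 2%:R) 0; pose c := cs 0 1 1.
have cn n : (1 < n)%N -> c ^+ n = X.
  case: n => [|[|n]] // _; elim: n => [|n IH]; first by rewrite expr2; cub_ring.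
  by rewrite exprS IH; cub_ring.
have cf : c * f = e by cub_ring.
have -> : jdt3 k.+1 = seq_mset [seq w.2 | w <- (one, (k.+2, 0%N)) ::
    up_strings f 2 1 (k.+1 - 2) ++ [:: (e, (1%N, 1%N)); (g, (1%N, k.+1 - 1)%N)]].
  by rewrite map_cons map_cat !up_strings_snd.
set strs := _ :: _.
have hit_one d : (d <= k.+1)%N -> reaches c strs d (c ^+ d).
  by move=> d_le; apply: (reaches_intro (mem_head _ _)); rewrite ?subn0 ?mulr1 //; lia.
have hit_f d : (0 < d < k)%N -> reaches c strs d f.
  move=> d_lt; apply: (@reaches_intro _ _ _ _ _ f 2 d); last by rewrite subnn mul1r.
    by rewrite in_cons mem_cat mem_up_strings; lia.
  lia.
have hit_e d : (0 < d <= k)%N -> reaches c strs d e.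
  move=> d_lt; have [d1|d_gt1] : d = 1%N \/ (1 < d)%N by lia.
    apply: (@reaches_intro _ _ _ _ _ e 1 1); rewrite ?d1 ?subnn ?mul1r //.
    by rewrite in_cons mem_cat mem_head !orbT.
  apply: (@reaches_intro _ _ _ _ _ f 2 d.-1).
  - by rewrite in_cons mem_cat mem_up_strings; lia.
  - lia.
  - by have -> : (d - d.-1 = 1)%N by [lia]; rewrite expr1.
have hit_g : reaches c strs k g.
  apply: (@reaches_intro _ _ _ _ _ g 1 (k.+1 - 1)%N); last by rewrite subn1 subnn mul1r.
    by rewrite in_cons mem_cat !in_cons eqxx !orbT.
  lia.
apply: (@pinched_occurs K 1 0 0 k split_nondeg k_gt0 c).
- by apply: cub_neq0; rewrite oner_neq0 orbT.
- rewrite /strs /= all_cat; apply/andP; split; last (apply/and4P; split=> //).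
  + by apply: good_long; rewrite ?eqxx ?addn0.
  + apply: all_up_strings => nu nu_le; apply: good_zero => //; first by lia.
    by rewrite cn //; cub_ring.
  + by apply: good_zero => //; rewrite expr1; cub_ring.
  + apply: good_top => //; first by rewrite subn1 k_gt0.
      by rewrite subn1.
    have -> : c ^+ 1 * g = cs 0 (-1) 1 by rewrite expr1; cub_ring.
    by rewrite topform_cub; ring.
- rewrite /strs /= map_cat sumn_cat !up_strings_sumn /=; lia.
- exact: hit_one.
- exists X; first by rewrite -(cn k.+1); [apply: hit_one|lia].
  by rewrite topform_cub mul0r mul1r add0r addr0 oner_neq0.
- move=> d /andP[d_gt0 d_le]; have [dk|d_ltk] : d = k \/ (d < k)%N by lia.
    exists X, e, g; rewrite dk; split=> //; first by rewrite -(cn k) //; apply: hit_one.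
      by apply: hit_e; rewrite k_gt0 /=.
    move=> y; exists (cX y + 2%:R * cunit y), (ceps y), (cunit y).
    by cub_ring.
  have [d1|d_gt1] : d = 1%N \/ (1 < d)%N by lia.
    exists c, e, f; split; [rewrite d1; exact: (hit_one 1%N)| by apply: hit_e;
      lia| by apply: hit_f; lia|].
    move=> y; exists (cX y + cunit y), (ceps y - cX y - cunit y), (cunit y).
    by cub_ring.
  exists X, e, f; split; [by rewrite -(cn d) //; apply: hit_one; lia| by apply: hit_e;
    lia| by apply: hit_f; lia|].
  move=> y; exists (cX y + cunit y), (ceps y), (cunit y).
  by cub_ring.
Qed.

(** c is the idempotent X, which kills 1 - X and e. *)
Lemma occurs4 : occurs K k (jdt4 k.+1).
Proof.
pose one : cubic (1 : K) 0 := 1; pose X := cs 0 1 0; pose e := cs 0 0 1;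
  pose f := cs 1 (-1) 0.
have Xn n : (0 < n)%N -> X ^+ n = X by apply: idem_exp; cub_ring.
have -> : jdt4 k.+1 = seq_mset [seq w.2 | w <- [:: (one, (k.+2, 0%N))] ++
    (up_strings f 1 1 (k.+1 - 1) ++ up_strings e 1 1 (k.+1 - 1))].
  by rewrite !map_cat !up_strings_snd.
apply: (@pinched_occurs K 1 0 0 k split_nondeg k_gt0 X).
- by apply: cub_neq0; rewrite oner_neq0 orbT.
- rewrite /= all_cat; apply/and3P; split.
  + by apply: good_long; rewrite ?eqxx ?addn0.
  + by apply: all_up_strings => nu nu_le; apply: good_zero => //; [lia|rewrite expr1;
      cub_ring].
  + by apply: all_up_strings => nu nu_le; apply: good_zero => //; [lia|rewrite expr1;
      cub_ring].
- rewrite !map_cat !sumn_cat !up_strings_sumn /=; lia.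
- by apply: (reaches_intro (mem_head _ _)); rewrite ?expr0 ?mul1r.
- exists X; last by rewrite topform_cub mul0r mul1r add0r addr0 oner_neq0.
  by apply: (reaches_intro (mem_head _ _)); rewrite ?subn0 ?Xn ?mulr1 //; lia.
- move=> d /andP[d_gt0 d_le]; exists X, f, e; split.
  + by apply: (reaches_intro (mem_head _ _)); rewrite ?subn0 ?Xn ?mulr1 //; lia.
  + by reach_up f 1%N d; rewrite subnn mul1r.
  + by reach_up e 1%N d; rewrite subnn mul1r.
  move=> y; exists (cX y + cunit y), (cunit y), (ceps y).
  by cub_ring.
Qed.

(** c = 1 and phi(1) = 0, so that the string of 1 stops in degree k and the one
of e reaches the top degree. *)
Lemma occurs5 : occurs K k (jdt5 k.+1).
Proof.
pose one : cubic (1 : K) 0 := 1; pose e := cs 0 0 1; pose g := cs 0 1 (-1).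
apply: (@pinched_occurs K 1 0 0 k split_nondeg k_gt0 one
  [:: (one, (k.+1, 0%N)); (e, (k.+1, 1%N)); (g, (k, 1%N))]).
- exact: oner_neq0.
- apply/and4P; split=> //.
  + by apply: good_top; rewrite ?eqxx ?orbT ?addn0 // expr1n mul1r topform_cub; ring.
  + by apply: good_long; rewrite ?addn1.
  + apply: good_top; rewrite ?addn1 // expr1n mul1r topform_cub; ring.
- rewrite /=; lia.
- by apply: (reaches_intro (mem_head _ _)); rewrite ?expr0 ?mul1r.
- exists e; last by rewrite topform_cub !mulr0 !add0r oner_neq0.
  by apply: (@reaches_intro _ _ _ _ _ e k.+1 1);
    rewrite ?inE ?eqxx ?orbT ?expr1n ?mul1r //; lia.
- move=> d /andP[d_gt0 d_le]; exists one, e, g; split.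
  + by apply: (reaches_intro (mem_head _ _)); rewrite ?expr1n ?mul1r //; lia.
  + by apply: (@reaches_intro _ _ _ _ _ e k.+1 1);
      rewrite ?inE ?eqxx ?orbT ?expr1n ?mul1r //; lia.
  + by apply: (@reaches_intro _ _ _ _ _ g k 1);
      rewrite ?inE ?eqxx ?orbT ?expr1n ?mul1r //; lia.
  move=> y; exists (cunit y), (ceps y + cX y), (cX y).
  by cub_ring.
Qed.

(** c is the idempotent f = 1 - X as in #2, with mu chosen such that
phi(f) = 0. *)
Lemma occurs6 : occurs K k (jdt6 k.+1).
Proof.
pose one : cubic (1 : K) 0 := 1; pose X := cs 0 1 0; pose e := cs 0 0 1;
  pose f := cs 1 (-1) 0.
have fX : f * X = 0 by cub_ring.
have fn n : (0 < n)%N -> f ^+ n = f by apply: idem_exp; cub_ring.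
have fe n : f ^+ n * e = e.
  elim: n => [|n IH]; first by rewrite mul1r.
  by rewrite exprS -mulrA IH; cub_ring.
have -> : jdt6 k.+1 = seq_mset [seq w.2 | w <- [:: (one, (k.+1, 0%N));
  (e, (k.+1, 1%N))] ++ up_strings X 1 1 (k.+1 - 1)].
  by rewrite map_cat !up_strings_snd.
apply: (@pinched_occurs K 1 0 1 k split_nondeg k_gt0 f).
- by apply: cub_neq0; rewrite oner_neq0.
- apply/and3P; split; last first.
  + by apply: all_up_strings => nu nu_le; apply: good_zero => //; lia.
  + by apply: good_long; rewrite ?addn1.
  + by apply: good_top; rewrite ?eqxx ?orbT ?addn0 // fn // mulr1 topform_cub; ring.
- rewrite map_cat sumn_cat !up_strings_sumn /=; lia.
- by apply: (reaches_intro (mem_head _ _)); rewrite ?expr0 ?mul1r.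
- exists e; last by rewrite topform_cub !mulr0 !add0r oner_neq0.
  by apply: (@reaches_intro _ _ _ _ _ e k.+1 1); rewrite ?inE ?eqxx ?orbT ?fe //; lia.
- move=> d /andP[d_gt0 d_le]; exists f, e, X; split.
  + by apply: (reaches_intro (mem_head _ _)); rewrite ?subn0 ?fn ?mulr1 //; lia.
  + by apply: (@reaches_intro _ _ _ _ _ e k.+1 1); rewrite ?inE ?eqxx ?orbT ?fe //; lia.
  + by reach_up X 1%N d; rewrite subnn mul1r.
  move=> y; exists (cunit y), (ceps y), (cX y + cunit y).
  by cub_ring.
Qed.

(** c = X in K[X]/(X^3); the strings of length 3 are t^d, Xt^(d+1),
X^2t^(d+2). *)
Lemma occurs7 : occurs K k (jdt7 k.+1).
Proof.
pose one : cubic (0 : K) 1 := 1; pose X := @cub K 0 1 0 1 0; pose e := @cub K 0 1 0 0 1.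
have XX : X ^+ 2 = e by rewrite expr2; cub_ring.
have X3 : X ^+ 3 = 0 by rewrite exprS XX; cub_ring.
have -> : jdt7 k.+1 = seq_mset [seq w.2 | w <- up_strings one 3 0 (k.+1 - 2) ++
    [:: (e, (1%N, 1%N)); (one, (1%N, k.+1 - 1)%N)]].
  by rewrite map_cat !up_strings_snd.
set strs := _ ++ _.
have hit2 d : (1 < d <= k.+1)%N -> reaches X strs d e.
  by move=> d_lt; reach_up one 3%N (d - 2)%N; have -> : (d - (d - 2) = 2)%N by [lia];
    rewrite XX mulr1.
have hit1 d : (0 < d <= k)%N -> reaches X strs d X.
  by move=> d_lt; reach_up one 3%N d.-1; have -> : (d - d.-1 = 1)%N by [lia]; rewrite mulr1.
have hit_one d : (d < k)%N -> reaches X strs d one.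
  by move=> d_lt; reach_up one 3%N d; rewrite subnn mulr1.
have hit_one_k : reaches X strs k one.
  apply: (@reaches_intro _ _ _ _ _ one 1 (k.+1 - 1)%N); last by rewrite subn1 subnn mul1r.
    by rewrite mem_cat !in_cons eqxx !orbT.
  lia.
have hit_e1 : reaches X strs 1 e.
  apply: (@reaches_intro _ _ _ _ _ e 1 1); rewrite ?subnn ?mul1r //.
  by rewrite mem_cat mem_head !orbT.
apply: (@pinched_occurs K 0 1 0 k local_nondeg k_gt0 X).
- by apply: cub_neq0; rewrite oner_neq0 orbT.
- rewrite /strs all_cat; apply/and4P; split=> //.
  + by apply: all_up_strings => nu nu_le; apply: good_zero; rewrite ?eqxx ?orbT // X3 mul0r.
  + by apply: good_zero => //; rewrite expr1; cub_ring.
  + by apply: good_top; rewrite ?eqxx ?orbT ?subn1 // expr1 mulr1 topform_cub; ring.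
- rewrite /strs map_cat sumn_cat !up_strings_sumn /=; lia.
- exact: hit_one.
- exists e; first by apply: hit2; rewrite ltnS k_gt0 leqnn.
  by rewrite topform_cub !mulr0 !add0r oner_neq0.
- move=> d /andP[d_gt0 d_le]; exists one, X, e; split.
  + by have [->|d_lt] : d = k \/ (d < k)%N by [lia]; [|apply: hit_one].
  + by apply: hit1; rewrite d_gt0.
  + by have [->|d_gt1] : d = 1%N \/ (1 < d)%N by [lia]; [|apply: hit2; lia].
  move=> y; exists (cunit y), (cX y), (ceps y).
  by cub_ring.
Qed.

End Examples.

(** * Realizing the type #9 *)

(** The coordinates are those in the basis 1; a, b, c; bc, ac, ab; abc of
K[a,b,c]/(a^2, b^2, c^2). *)
Definition squarefree (K : fieldType) : Type := 'rV[K]_8.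

Section Squarefree.

Variable K : fieldType.
Local Notation S := (squarefree K).
Local Notation V := 'rV[K]_3.

HB.instance Definition _ := Vector.copy S 'rV[K]_8.

Definition sco (a : S) (i : nat) : K := (a : 'rV[K]_8) 0 (inord i).

Definition sqf (u x1 x2 x3 y1 y2 y3 z : K) : S :=
  \row_(i < 8) nth 0 [:: u; x1; x2; x3; y1; y2; y3; z] i.

Lemma sco_sqf u x1 x2 x3 y1 y2 y3 z i : (i < 8)%N ->
  sco (sqf u x1 x2 x3 y1 y2 y3 z) i = nth 0 [:: u; x1; x2; x3; y1; y2; y3; z] i.
Proof. by move=> i_lt; rewrite /sco mxE inordK. Qed.

Lemma sqfE (a : S) :
  a = sqf (sco a 0) (sco a 1) (sco a 2) (sco a 3) (sco a 4) (sco a 5) (sco a 6) (sco a 7).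
Proof.
apply/rowP => i; rewrite mxE -[i in LHS]inord_val.
by case: i => -[|[|[|[|[|[|[|[|i]]]]]]]].
Qed.

Lemma sqfD u x1 x2 x3 y1 y2 y3 z u' x1' x2' x3' y1' y2' y3' z' :
  sqf u x1 x2 x3 y1 y2 y3 z + sqf u' x1' x2' x3' y1' y2' y3' z' =
  sqf (u + u') (x1 + x1') (x2 + x2') (x3 + x3') (y1 + y1') (y2 + y2') (y3 + y3') (z + z').
Proof. by apply/rowP => i; rewrite !mxE; case: i => -[|[|[|[|[|[|[|[|i]]]]]]]]. Qed.

Lemma sqfZ c u x1 x2 x3 y1 y2 y3 z : c *: sqf u x1 x2 x3 y1 y2 y3 z =
  sqf (c * u) (c * x1) (c * x2) (c * x3) (c * y1) (c * y2) (c * y3) (c * z).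
Proof. by apply/rowP => i; rewrite !mxE; case: i => -[|[|[|[|[|[|[|[|i]]]]]]]]. Qed.

Lemma sqf0 : 0 = sqf 0 0 0 0 0 0 0 0.
Proof. by apply/rowP => i; rewrite !mxE; case: i => -[|[|[|[|[|[|[|[|i]]]]]]]]. Qed.

Definition sqf_mul (a b : S) : S :=
  let c i := sco a i in let d i := sco b i in
  sqf (c 0 * d 0) (c 0 * d 1 + c 1 * d 0) (c 0 * d 2 + c 2 * d 0) (c 0 * d 3 + c 3 * d 0)
    (c 0 * d 4 + c 4 * d 0 + c 2 * d 3 + c 3 * d 2) (c 0 * d 5 + c 5 * d 0 + c 1 * d 3 +
      c 3 * d 1)
    (c 0 * d 6 + c 6 * d 0 + c 1 * d 2 + c 2 * d 1)
    (c 0 * d 7 + c 7 * d 0 + c 1 * d 4 + c 4 * d 1 + c 2 * d 5 + c 5 * d 2 + c 3 * d 6 +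
      c 6 * d 3).

Lemma sqf_mulE u x1 x2 x3 y1 y2 y3 z u' x1' x2' x3' y1' y2' y3' z' :
  sqf_mul (sqf u x1 x2 x3 y1 y2 y3 z) (sqf u' x1' x2' x3' y1' y2' y3' z') =
  sqf (u * u') (u * x1' + x1 * u') (u * x2' + x2 * u') (u * x3' + x3 * u')
    (u * y1' + y1 * u' + x2 * x3' + x3 * x2') (u * y2' + y2 * u' + x1 * x3' + x3 * x1')
    (u * y3' + y3 * u' + x1 * x2' + x2 * x1')
    (u * z' + z * u' + x1 * y1' + y1 * x1' + x2 * y2' + y2 * x2' + x3 * y3' + y3 * x3').
Proof. by rewrite /sqf_mul !sco_sqf. Qed.

Fact sqf_mulA : associative sqf_mul.
Proof.
by move=> a b c; rewrite (sqfE a) (sqfE b) (sqfE c) !sqf_mulE; congr sqf; ring.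
Qed.
Fact sqf_mulC : commutative sqf_mul.
Proof. by move=> a b; rewrite (sqfE a) (sqfE b) !sqf_mulE; congr sqf; ring. Qed.
Fact sqf_mul1 : left_id (sqf 1 0 0 0 0 0 0 0) sqf_mul.
Proof. by move=> a; rewrite (sqfE a) !sqf_mulE; congr sqf; ring. Qed.
Fact sqf_mulDl : left_distributive sqf_mul +%R.
Proof.
by move=> a b c; rewrite (sqfE a) (sqfE b) (sqfE c) sqfD !sqf_mulE sqfD; congr sqf; ring.
Qed.
Fact sqf_1_neq0 : sqf 1 0 0 0 0 0 0 0 != 0.
Proof.
apply/eqP => /(congr1 (fun a => sco a 0)).
by rewrite sqf0 !sco_sqf // => /eqP; rewrite oner_eq0.
Qed.

HB.instance Definition _ := GRing.Zmodule_isComNzRing.Build S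
  sqf_mulA sqf_mulC sqf_mul1 sqf_mulDl sqf_1_neq0.

Lemma sqf1 : (1 : S) = sqf 1 0 0 0 0 0 0 0.
Proof. by []. Qed.

Lemma sqfM u x1 x2 x3 y1 y2 y3 z u' x1' x2' x3' y1' y2' y3' z' :
  sqf u x1 x2 x3 y1 y2 y3 z * sqf u' x1' x2' x3' y1' y2' y3' z' =
  sqf (u * u') (u * x1' + x1 * u') (u * x2' + x2 * u') (u * x3' + x3 * u')
    (u * y1' + y1 * u' + x2 * x3' + x3 * x2') (u * y2' + y2 * u' + x1 * x3' + x3 * x1')
    (u * y3' + y3 * u' + x1 * x2' + x2 * x1')
    (u * z' + z * u' + x1 * y1' + y1 * x1' + x2 * y2' + y2 * x2' + x3 * y3' + y3 * x3').
Proof. exact: sqf_mulE. Qed.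

Fact sqf_scaleAl (c : K) (a b : S) : c *: sqf_mul a b = sqf_mul (c *: a) b.
Proof.
by rewrite (sqfE a) (sqfE b) sqf_mulE !sqfZ sqf_mulE; congr sqf; ring.
Qed.
HB.instance Definition _ := GRing.Lmodule_isLalgebra.Build K S sqf_scaleAl.
HB.instance Definition _ := GRing.Lalgebra_isComAlgebra.Build K S.
HB.instance Definition _ := Algebra_isFalgebra.Build K S.

Definition sqf_emb1 (v : V) : S := sqf 0 (v 0 0) (v 0 1) (v 0 2%:R) 0 0 0 0.
Definition sqf_emb2 (v : V) : S := sqf 0 0 0 0 (v 0 0) (v 0 1) (v 0 2%:R) 0.

Lemma sqf_emb1_linear : linear sqf_emb1.
Proof. by move=> c v w; rewrite /sqf_emb1 sqfZ sqfD !mxE !mulr0 !addr0. Qed.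
HB.instance Definition _ := GRing.isLinear.Build K V S *:%R sqf_emb1 sqf_emb1_linear.

Lemma sqf_emb2_linear : linear sqf_emb2.
Proof. by move=> c v w; rewrite /sqf_emb2 sqfZ sqfD !mxE !mulr0 !addr0. Qed.
HB.instance Definition _ := GRing.isLinear.Build K V S *:%R sqf_emb2 sqf_emb2_linear.

Definition row3 (x y z : K) : V := \row_(i < 3) nth 0 [:: x; y; z] i.

Lemma row3_eq0 (v : V) : v 0 0 = 0 -> v 0 1 = 0 -> v 0 2%:R = 0 -> v = 0.
Proof.
move=> v0 v1 v2; apply/rowP => i; rewrite mxE; case: i => -[|[|[|i]]] // i_lt.
- by rewrite -[RHS]v0; congr (v 0 _); apply: val_inj.
- by rewrite -[RHS]v1; congr (v 0 _); apply: val_inj.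
- by rewrite -[RHS]v2; congr (v 0 _); apply: val_inj.
Qed.

Definition sqf_deg (d : nat) : {vspace S} :=
  match d with
  | 0%N => <[sqf 1 0 0 0 0 0 0 0]>%VS | 1%N => limg (linfun sqf_emb1) | 2%N =>
    limg (linfun sqf_emb2)
  | 3%N => <[sqf 0 0 0 0 0 0 0 1]>%VS | _ => 0%VS
  end.

Definition sqf_proj (d : nat) (a : S) : S :=
  match d with
  | 0%N => sqf (sco a 0) 0 0 0 0 0 0 0 | 1%N => sqf 0 (sco a 1) (sco a 2) (sco a 3) 0 0 0 0
  | 2%N => sqf 0 0 0 0 (sco a 4) (sco a 5) (sco a 6) 0
  | 3%N => sqf 0 0 0 0 0 0 0 (sco a 7) | _ => 0
  end.

Lemma sqf_deg0 : sqf_deg 0 = 1%VS.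
Proof. by rewrite /= -sqf1. Qed.

Lemma sqf_deg1P a : reflect (exists x y z, a = sqf 0 x y z 0 0 0 0) (a \in sqf_deg 1).
Proof.
apply: (iffP memv_imgP) => [[v _ ->]|[x [y [z ->]]]].
  by exists (v 0 0), (v 0 1), (v 0 2%:R); rewrite lfunE.
by exists (row3 x y z); rewrite ?memvf // lfunE /= /sqf_emb1 !mxE.
Qed.

Lemma sqf_deg2P a : reflect (exists x y z, a = sqf 0 0 0 0 x y z 0) (a \in sqf_deg 2).
Proof.
apply: (iffP memv_imgP) => [[v _ ->]|[x [y [z ->]]]].
  by exists (v 0 0), (v 0 1), (v 0 2%:R); rewrite lfunE.
by exists (row3 x y z); rewrite ?memvf // lfunE /= /sqf_emb2 !mxE.
Qed.

Lemma sqf_deg0P a : reflect (exists x, a = sqf x 0 0 0 0 0 0 0) (a \in sqf_deg 0).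
Proof.
by apply: (iffP (vlineP _ _)) => -[c ->]; exists c; rewrite sqfZ !mulr0 mulr1.
Qed.

Lemma sqf_deg3P a : reflect (exists x, a = sqf 0 0 0 0 0 0 0 x) (a \in sqf_deg 3).
Proof.
by apply: (iffP (vlineP _ _)) => -[c ->]; exists c; rewrite sqfZ !mulr0 mulr1.
Qed.

Lemma scoD a b i : sco (a + b) i = sco a i + sco b i.
Proof. by rewrite /sco mxE. Qed.

Lemma sqf_projD d : {morph sqf_proj d : a b / a + b}.
Proof. by case: d => [|[|[|[|d]]]] a b; rewrite /= ?scoD ?sqfD ?addr0. Qed.

Lemma sqf_proj_mem d a : sqf_proj d a \in sqf_deg d.
Proof.
case: d => [|[|[|[|d]]]]; last exact: mem0v.
- by apply/sqf_deg0P; eexists.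
- by apply/sqf_deg1P; do 3!eexists.
- by apply/sqf_deg2P; do 3!eexists.
- by apply/sqf_deg3P; eexists.
Qed.

Lemma sqf_proj_case d e : {in sqf_deg e, forall a, sqf_proj d a = if d == e then a else 0}.
Proof.
case: e => [|[|[|[|e]]]] a.
- by case/sqf_deg0P => x ->; case: d => [|[|[|[|d]]]] //=; rewrite !sco_sqf // -sqf0.
- by case/sqf_deg1P => x [y [z ->]]; case: d => [|[|[|[|d]]]] //=;
    rewrite !sco_sqf // -sqf0.
- by case/sqf_deg2P => x [y [z ->]]; case: d => [|[|[|[|d]]]] //=;
    rewrite !sco_sqf // -sqf0.
- by case/sqf_deg3P => x ->; case: d => [|[|[|[|d]]]] //=; rewrite !sco_sqf // -sqf0.
- rewrite memv0 => /eqP->; rewrite if_same.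
  by case: d => [|[|[|[|d]]]] //=; rewrite sqf0 !sco_sqf.
Qed.

Lemma sqf_proj_sum a : a = \sum_(d < 4) sqf_proj d a.
Proof.
rewrite !big_ord_recr big_ord0 /= add0r !sqfD [LHS]sqfE.
by rewrite !addr0 !add0r.
Qed.

Definition sqf_gens (i : 'I_3) : S :=
  nth 0 [:: sqf 0 1 0 0 0 0 0 0; sqf 0 0 1 0 0 0 0 0; sqf 0 0 0 1 0 0 0 0] i.

Lemma sqf_deg1 : sqf_deg 1 = <<[seq sqf_gens i | i : 'I_3]>>%VS.
Proof.
apply/eqP; rewrite eqEsubv; apply/andP; split; last first.
  apply/span_subvP => _ /imageP[i _ ->]; apply/sqf_deg1P.
  by case: i => -[|[|[|i]]] i_lt //=; do 3!eexists.
apply/subvP => _ /sqf_deg1P[x [y [z ->]]].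
have -> : sqf 0 x y z 0 0 0 0 = x *: sqf 0 1 0 0 0 0 0 0 + y *: sqf 0 0 1 0 0 0 0 0 + z
  *: sqf 0 0 0 1 0 0 0 0.
  by rewrite !sqfZ !sqfD; congr sqf; ring.
have gen_in (i : 'I_3) : sqf_gens i \in <<[seq sqf_gens i | i : 'I_3]>>%VS by
  apply/memv_span/image_f.
do ![apply: memvD | apply: memvZ].
- exact: (gen_in ord0).
- exact: (gen_in (@Ordinal 3 1 isT)).
- exact: (gen_in (@Ordinal 3 2 isT)).
Qed.

Lemma sqf_degS d : sqf_deg d.+1 = (sqf_deg 1 * sqf_deg d)%VS.
Proof.
have mem1 x y z : sqf 0 x y z 0 0 0 0 \in sqf_deg 1 by apply/sqf_deg1P; exists x, y, z.
case: d => [|[|[|[|d]]]]; last by rewrite prodv0.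
- by rewrite sqf_deg0 prodv1.
- apply/eqP; rewrite eqEsubv; apply/andP; split; last first.
    apply/prodvP => _ _ /sqf_deg1P[x [y [z ->]]] /sqf_deg1P[x' [y' [z' ->]]].
    apply/sqf_deg2P; exists (y * z' + z * y'), (x * z' + z * x'), (x * y' + y * x').
    by rewrite sqfM; congr sqf; ring.
  apply/subvP => _ /sqf_deg2P[x [y [z ->]]].
  have -> : sqf 0 0 0 0 x y z 0 = sqf 0 0 x 0 0 0 0 0 * sqf 0 0 0 1 0 0 0 0
     + sqf 0 0 0 y 0 0 0 0 * sqf 0 1 0 0 0 0 0 0 + sqf 0 z 0 0 0 0 0 0 * sqf 0 0 1 0 0 0
         0 0.
    by rewrite !sqfM !sqfD; congr sqf; ring.
  by rewrite !memvD ?memv_mul ?mem1.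
- apply/eqP; rewrite eqEsubv; apply/andP; split; last first.
    apply/prodvP => _ _ /sqf_deg1P[x [y [z ->]]] /sqf_deg2P[x' [y' [z' ->]]].
    apply/sqf_deg3P; exists (x * x' + y * y' + z * z').
    by rewrite sqfM; congr sqf; ring.
  apply/subvP => _ /sqf_deg3P[x ->].
  have -> : sqf 0 0 0 0 0 0 0 x = sqf 0 x 0 0 0 0 0 0 * sqf 0 0 0 0 1 0 0 0.
    by rewrite sqfM; congr sqf; ring.
  by rewrite memv_mul ?mem1 //; apply/sqf_deg2P; exists 1, 0, 0.
- apply/esym/eqP; rewrite -subv0;
    apply/prodvP => _ _ /sqf_deg1P[x [y [z ->]]] /sqf_deg3P[x' ->].
  by rewrite memv0 sqfM sqf0; apply/eqP; congr sqf; ring.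
Qed.

Lemma dim_sqf_deg d : \dim (sqf_deg d) = T131 2 d.
Proof.
have line_dim u x1 x2 x3 y1 y2 y3 z i : (i < 8)%N -> nth 0 [:: u; x1; x2; x3; y1; y2; y3;
  z] i = 1 ->
    \dim <[sqf u x1 x2 x3 y1 y2 y3 z]> = 1%N.
  move=> i_lt ai; rewrite dim_vline; apply/eqP; rewrite eqb1; apply/eqP.
  by rewrite sqf0 => /(congr1 (fun a => sco a i)) /eqP; rewrite !sco_sqf // ai;
     case: i i_lt {ai} => [|[|[|[|[|[|[|[|i]]]]]]]] //= _; rewrite oner_eq0.
case: d => [|[|[|[|d]]]]; last by rewrite dimv0 /T131 nth_default.
- exact: (line_dim _ _ _ _ _ _ _ _ 0%N).
- rewrite limg_dim_eq ?dimvf /dim //=; apply/eqP; rewrite -subv0; apply/subvP => v.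
  rewrite memv_cap memv_ker lfunE memv0 /= => /andP[_ /eqP ev0]; apply/eqP.
  have E i (i_lt : (i < 8)%N) := congr1 (fun a => sco a i) ev0.
  have := E 1%N isT; have := E 2 isT; have := E 3 isT;
    rewrite sqf0 !sco_sqf //= => v2 v1 v0.
  exact: row3_eq0.
- rewrite limg_dim_eq ?dimvf /dim //=; apply/eqP; rewrite -subv0; apply/subvP => v.
  rewrite memv_cap memv_ker lfunE memv0 /= => /andP[_ /eqP ev0]; apply/eqP.
  have E i (i_lt : (i < 8)%N) := congr1 (fun a => sco a i) ev0.
  have := E 4 isT; have := E 5 isT; have := E 6 isT; rewrite sqf0 !sco_sqf //= => v2 v1 v0.
  exact: row3_eq0.
- exact: (line_dim _ _ _ _ _ _ _ _ 7).
Qed.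

Lemma sqf_socle (a : S) : {in sqf_deg 1, forall y, y * a = 0} -> a \in sqf_deg 3.
Proof.
move=> soc; have mem1 x y z : sqf 0 x y z 0 0 0 0 \in sqf_deg 1 by apply/sqf_deg1P;
  exists x, y, z.
have coords x y z i (i_lt : (i < 8)%N) := congr1 (fun b => sco b i) (soc _ (mem1 x y z)).
apply/sqf_deg3P; exists (sco a 7); rewrite [LHS]sqfE.
have := coords 1 0 0; have := coords 0 1 0; have := coords 0 0 1.
rewrite [a in _ * a]sqfE sqfM sqf0 => c3 c2 c1.
have := c1 1%N isT; have := c2 6 isT; have := c1 5 isT; have := c1 6 isT; have := c1 7 isT.
have := c2 7 isT; have := c3 7 isT; rewrite !sco_sqf //= !(mul0r, mul1r, addr0, add0r).
by move=> -> -> -> -> -> -> ->.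
Qed.

(** The strings of l = a are 1, a; b, ab; c, ac; bc, abc. *)
Lemma occurs9 : occurs K 2 jdt9.
Proof.
have sprid d : {in sqf_deg d, forall a, sqf_proj d a = a} by move=> a /sqf_proj_case->;
  rewrite eqxx.
have spr0 d e : d != e -> {in sqf_deg e, forall a, sqf_proj d a = 0}.
  by move=> /negbTE de a /sqf_proj_case->; rewrite de.
have [pi [gor AdegE]] := @Gor_grading K S 2 sqf_gens sqf_deg sqf_proj (@mulrC S) sqf_deg0
  sqf_deg1 sqf_degS
  sqf_projD sprid spr0 sqf_proj_sum sqf_proj_mem dim_sqf_deg sqf_socle.
pose l := sqf 0 1 0 0 0 0 0 0.
exists S, pi, l; split=> //.
- by rewrite AdegE; apply/sqf_deg1P; exists 1, 0, 0.
- by apply/eqP; rewrite sqf0 => /(congr1 (fun a => sco a 1)) /eqP;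
    rewrite !sco_sqf //= oner_eq0.
have ll : l ^+ 2 = 0 by rewrite expr2 sqfM sqf0; congr sqf; ring.
pose strs := [:: (sqf 1 0 0 0 0 0 0 0, (2, 0)); (sqf 0 0 1 0 0 0 0 0, (2, 1));
  (sqf 0 0 0 0 1 0 0 0, (2, 2)); (sqf 0 0 0 1 0 0 0 0, (2, 1))]%N.
have -> : jdt9 = seq_mset [seq w.2 | w <- strs] by [].
apply: (is_JDT_spanning gor) => //.
  move=> v p nu; rewrite !inE => w_in; have -> : p = 2 by case/or4P: w_in => /eqP[].
  split=> //; last by rewrite ll mul0r.
  rewrite AdegE; case/or4P: w_in => /eqP[-> _ ->].
  - by apply/sqf_deg0P; exists 1.
  - by apply/sqf_deg1P; exists 0, 1, 0.
  - by apply/sqf_deg2P; exists 1, 0, 0.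
  - by apply/sqf_deg1P; exists 0, 0, 1.
pose basis := [:: sqf 1 0 0 0 0 0 0 0; sqf 0 1 0 0 0 0 0 0; sqf 0 0 1 0 0 0 0 0;
  sqf 0 0 0 0 0 0 1 0; sqf 0 0 0 0 1 0 0 0; sqf 0 0 0 0 0 0 0 1;
  sqf 0 0 0 1 0 0 0 0; sqf 0 0 0 0 0 1 0 0].
have -> : flatten [seq [seq l ^+ a * w.1 | a <- iota 0 w.2.1] | w <- strs] = basis.
  rewrite /= !expr0 !expr1 !mul1r !sqfM !(mul0r, mulr0, mul1r, mulr1, addr0, add0r).
  by [].
have in_span v : v \in basis -> v \in <<basis>>%VS by apply: memv_span.
move=> d d_lt; rewrite AdegE; apply/subvP => a.
case: d d_lt => [|[|[|[|d]]]] // _.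
- move=> /vlineP[c ->]; rewrite memvZ // in_span // mem_head //.
- case/sqf_deg1P => x [y [z ->]].
  have -> : sqf 0 x y z 0 0 0 0 = x *: nth 0 basis 1 + y *: nth 0 basis 2 + z *: nth 0
    basis 6.
    by rewrite !sqfZ !sqfD; congr sqf; ring.
  by rewrite !memvD ?memvZ ?in_span ?mem_nth.
- case/sqf_deg2P => x [y [z ->]].
  have -> : sqf 0 0 0 0 x y z 0 = x *: nth 0 basis 4 + y *: nth 0 basis 7 + z *: nth 0
    basis 3.
    by rewrite !sqfZ !sqfD; congr sqf; ring.
  by rewrite !memvD ?memvZ ?in_span ?mem_nth.
- case/sqf_deg3P => x ->.
  have -> : sqf 0 0 0 0 0 0 0 x = x *: nth 0 basis 5 by rewrite sqfZ; congr sqf; ring.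
  by rewrite memvZ ?in_span ?mem_nth.
Qed.

End Squarefree.

(** * The classification *)

Local Open Scope nat_scope.

Lemma occurs_classified (K : fieldType) (char0 : [pchar K]%R =i pred0) k D :
  0 < k -> occurs K k D ->
  [/\ k = 1 -> D = jdt1 2 \/ D = jdt8 2, k = 2 -> D \in rcons (jdts 3) jdt9
    & 2 < k -> D \in jdts k.+1].
Proof.
move=> k_gt0 [A [pi [l [gor lG l_neq0 JD]]]].
have two_neq0 : (2%:R != 0 :> K)%R by apply/negP => two0; have := char0 2;
  rewrite !inE /= two0.
have [] := jdt_classified (Gor_graded_gorenstein gor) two_neq0 (fun d =>
  Gor_dim3 gor) lG l_neq0 JD.
move=> c2 c3 c4; split=> k_case; [by apply: c2; rewrite k_case|by apply: c3;
  rewrite k_case|exact: c4].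
Qed.

Theorem theorem4p6 (K : fieldType) (char0 : [pchar K]%R =i pred0) :
  (* A *)
  (forall k : nat, 3 <= k ->
     uniq (jdts k.+1) /\
     (forall D : {mset nat * nat}, occurs K k D <-> D \in jdts k.+1)) /\
  (* B, k = 2 *)
  (jdt2 3 = jdt3 3 /\ jdt6 3 = jdt7 3 /\
   uniq [:: jdt1 3; jdt2 3; jdt4 3; jdt5 3; jdt6 3; jdt8 3; jdt9] /\
   (forall D : {mset nat * nat},
      occurs K 2 D <-> D \in rcons (jdts 3) jdt9)) /\
  (* B, k = 1 *)
  (jdt1 2 <> jdt8 2 /\
   (forall D : {mset nat * nat},
      occurs K 1 D <-> D \in [:: jdt1 2; jdt8 2])).
Proof.
have jdts_occur k D : 2 <= k -> D \in jdts k.+1 -> occurs K k D.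
  move=> k2; have k1 : 0 < k by apply: ltnW.
  rewrite /jdts; do 7!(case/predU1P=> [->|]; first by
    [exact: occurs1|exact: occurs2|exact: occurs3|exact: occurs4|exact: occurs5|
     exact: occurs6|exact: occurs7]).
  by case/predU1P=> [->|//]; apply: occurs8.
split; [|split].
- move=> k k3; split; first exact: jdts_uniq.
  move=> D; split; last by apply: jdts_occur; apply: ltnW.
  by case/(@occurs_classified _ char0); [exact: ltn_trans k3|move=> _ _ ->].
- split; [exact: jdt2_eq_jdt3|split; [exact: jdt6_eq_jdt7|split; [exact: jdts3_uniq|]]].
  move=> D; split; first by case/(@occurs_classified _ char0) => // _ ->.
  by rewrite mem_rcons in_cons => /predU1P[->|]; [apply: occurs9|apply: jdts_occur].
- split; [exact: jdt1_neq_jdt8|move=> D; split].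
    case/(@occurs_classified _ char0) => // /(_ erefl) D_case _ _; apply/predU1P.
    by case: D_case => [->|->]; [left|right; rewrite eqxx].
  case/predU1P=> [->|]; first exact: occurs1.
  by case/predU1P=> [->|//]; apply: occurs8.
Qed.
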